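(* Let $G$ be a simple graph on $[n]$ with connected components $G_1,\dots,G_r$, let $K$ be a field, let $S=K[x_1,\dots,x_n,y_1,\dots,y_n]$, and for each $i$ let $S_i=K[x_j,y_j \mid j\in V(G_i)]$ be the polynomial ring in the indeterminates indexed by the vertices of $G_i$, with $J_{G_i}\subseteq S_i$. Then $$\mathrm{v}(J_G)=\mathrm{v}(J_{G_1}S+\dots+J_{G_r}S)=\mathrm{v}(J_{G_1})+\dots+\mathrm{v}(J_{G_r}).$$
   Context: $[n]=\{1,\dots,n\}$. Graphs are finite and simple (no loops, no multiple edges). Polynomial rings have the standard grading. Binomial edge ideal: for a graph $H$ with $V(H)\subseteq[n]$, $J_H$ is the ideal generated by the binomials $x_iy_j-x_jy_i$ with $\{i,j\}\in E(H)$, $i<j$, in the polynomial ring $K[x_k,y_k\mid k\in V(H)]$. v-number: for a homogeneous ideal $I$ of a standard graded polynomial ring $R=\bigoplus_{d\ge 0}R_d$, $\mathrm{v}(I):=\min\{d\ge 0\mid \exists f\in R_d \text{ and } \mathfrak{p}\in\operatorname{Ass}(I)\text{ with } (I:f)=\mathfrak{p}\}$, where $\operatorname{Ass}(I)$ is the set of associated primes of $R/I$. *)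

(* Defs.v *)
From Stdlib Require Import ClassicalEpsilon.
From mathcomp Require Import all_boot all_algebra.
From mathcomp Require Export mpoly.

Set Implicit Arguments.
Unset Strict Implicit.
Unset Printing Implicit Defensive.

Import GRing.Theory.
Local Open Scope ring_scope.

(* Ideals are Prop-valued predicates, compared extensionally: the ideals of
   ring_quotient require a boolean membership test. *)

Section Ideals.
Variable R : comNzRingType.
Implicit Types (I P : R -> Prop) (f : R).

Definition is_ideal I : Prop :=
  [/\ I 0, forall a b, I a -> I b -> I (a + b) & forall c a, I a -> I (c * a)].

Definition prime_ideal P : Prop :=
  [/\ is_ideal P, ~ P 1 & forall a b, P (a * b) -> P a \/ P b].

Definition ideal_gen (B : R -> Prop) : R -> Prop :=
  fun p => exists (m : nat) (c b : 'I_m -> R),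
    (forall k, B (b k)) /\ p = \sum_(k < m) c k * b k.

Definition ideal_sum (T : finType) (D : {set T}) (I : T -> R -> Prop) :
    R -> Prop :=
  fun p => exists f : T -> R,
    (forall t, t \in D -> I t (f t)) /\ p = \sum_(t in D) f t.

Definition colon I f : R -> Prop := fun g => I (g * f).

(* (I : f) is the annihilator of the class of f in R/I. *)
Definition assoc_prime I P : Prop :=
  prime_ideal P /\ exists f, forall g, colon I f g <-> P g.

End Ideals.

Definition ideal_extension (R S : comNzRingType) (phi : R -> S)
    (I : R -> Prop) : S -> Prop :=
  ideal_gen (fun q => exists2 p, I p & q = phi p).

Definition is_least (P : nat -> Prop) (d : nat) : Prop :=
  P d /\ forall k, P k -> (d <= k)%N.

Section VNumber.
Variables (K : fieldType) (N : nat).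
Implicit Type I : {mpoly K[N]} -> Prop.

Definition vnumber_witness I (d : nat) : Prop :=
  exists (f : {mpoly K[N]}) (P : {mpoly K[N]} -> Prop),
    [/\ f \is d.-homog, assoc_prime I P & forall g, colon I f g <-> P g].

(* The minimum is taken with Hilbert's epsilon; the value is unspecified when
   no degree admits a witness, which does not happen for a proper homogeneous
   ideal. *)
Definition vnumber I : nat :=
  epsilon (inhabits 0%N) (is_least (vnumber_witness I)).

Lemma vnumberP I :
  (exists d, vnumber_witness I d) -> is_least (vnumber_witness I) (vnumber I).
Proof.
move=> [d Wd]; apply: epsilon_spec.
elim/ltn_ind: d Wd => d IHd Wd.
case: (classic (exists2 k, (k < d)%N & vnumber_witness I k)) => [[k lt_kd Wk]|noW].
  exact: IHd lt_kd Wk.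
exists d; split=> // k Wk; rewrite leqNgt; apply/negP => lt_kd.
by apply: noW; exists k.
Qed.

End VNumber.

(* The vertex set [m] is 'I_m = {0, ..., m - 1}. *)
Record simple_graph (m : nat) := SimpleGraph {
  edge :> rel 'I_m;
  edge_sym : ssrbool.symmetric edge;
  edge_irr : irreflexive edge
}.

(* The subgraph of G induced on A, its vertices being renumbered 0, ..., #|A|-1
   in increasing order: vertex k of the result is the vertex enum_val k of G. *)
Section Induced.
Variables (n : nat) (G : simple_graph n) (A : {set 'I_n}).

Definition induced_edge : rel 'I_#|A| :=
  fun i j => G (enum_val i) (enum_val j).

Lemma induced_sym : ssrbool.symmetric induced_edge.
Proof. by move=> i j; apply: edge_sym. Qed.

Lemma induced_irr : irreflexive induced_edge.
Proof. by move=> i; apply: edge_irr. Qed.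

Definition induced : simple_graph #|A| := SimpleGraph induced_sym induced_irr.

End Induced.

(* The vertex sets of the connected components. *)
Definition components (n : nat) (G : simple_graph n) : {set {set 'I_n}} :=
  equivalence_partition (connect G) [set: 'I_n].

(* {mpoly K[m + m]} is K[x_1, ..., x_m, y_1, ..., y_m]: the first m
   indeterminates are the x's, the last m are the y's. *)
Section BinomialEdgeIdeal.
Variable K : fieldType.

Definition xvar (m : nat) (i : 'I_m) : {mpoly K[m + m]} := 'X_(lshift m i).
Definition yvar (m : nat) (i : 'I_m) : {mpoly K[m + m]} := 'X_(rshift m i).

Definition binomial_edge_ideal (m : nat) (H : simple_graph m) :
    {mpoly K[m + m]} -> Prop :=
  ideal_gen (fun p => exists i j : 'I_m,
    [/\ H i j, (i < j)%N & p = xvar i * yvar j - xvar j * yvar i]).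

(* The inclusion of K[x_j, y_j | j in A] into K[x_1, ..., x_n, y_1, ..., y_n],
   with the indeterminates of the former numbered as in [induced]. *)
Definition var_incl (n : nat) (A : {set 'I_n}) (v : 'I_(#|A| + #|A|)) :
    {mpoly K[n + n]} :=
  match split v with
  | inl k => xvar (enum_val k)
  | inr k => yvar (enum_val k)
  end.

Definition poly_incl (n : nat) (A : {set 'I_n})
    (p : {mpoly K[#|A| + #|A|]}) : {mpoly K[n + n]} :=
  mmap (@mpolyC (n + n) K) (@var_incl n A) p.

End BinomialEdgeIdeal.

Arguments binomial_edge_ideal K {m} H _.
Arguments poly_incl K {n} A p.

(* Main.v *)
Require Import Defs.
From HB Require Import structures.
From Stdlib Require Import ClassicalEpsilon FunctionalExtensionality PropExtensionality.
From mathcomp Require Import all_boot all_algebra ring.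

(* Write x_i, y_i for the variables of vertex i, and f_ij = x_i y_j - x_j y_i.

   For a vertex v with neighbourhood N(v), both x_v and y_v multiply f_ij into
   J_G when i, j are in N(v). Hence p lies in J_G iff p lies in J_{G_v}, where
   G_v completes N(v) to a clique, and p with x_v, y_v set to 0 lies in
   J_{G - v}. Iterating until every component is a clique, where J_G is the
   kernel of the monomial map x_i -> u_C t_i, y_i -> v_C t_i (C the component of
   i), writes J_G as a finite intersection of kernels of substitutions into
   polynomial rings. So the associated primes are such kernels, which stay prime
   under base change.

   Let I be generated by I_1 and I_2 in disjoint sets of variables, and expand
   polynomials as sums of u_a v_a, the u_a being independent modulo I_1 and the
   v_a modulo I_2. If (I : f) = P is prime and f = sum of u_a v_a, then the
   contraction of P to the first (second) block of variables carries every u_a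
   into I_1 (v_a into I_2), and P being prime, (I : u_a v_a) = P for some a; so f
   may be replaced by a product. Conversely, if (I_i : f_i) is the kernel of phi_i, then
   (I : f_1 f_2) is the kernel of the tensor product of phi_1 and phi_2, which is
   prime. Hence v(I) = v(I_1) + v(I_2). *)

Set Implicit Arguments.
Unset Strict Implicit.
Unset Printing Implicit Defensive.

Import GRing.Theory.
Local Open Scope ring_scope.

(** * Ideals of commutative rings *)

Section IdealTheory.
Variable R : comNzRingType.
Implicit Types (I J B : R -> Prop) (p q : R).

Lemma ideal_opp I p : is_ideal I -> I p -> I (- p).
Proof. by move=> [_ _ IM] Ip; rewrite -mulN1r; apply: IM. Qed.

Lemma ideal_sub I p q : is_ideal I -> I p -> I q -> I (p - q).
Proof. by move=> idI Ip Iq; have [_ ID _] := idI; apply: ID => //; apply: ideal_opp. Qed.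

Lemma ideal_mulr I p q : is_ideal I -> I p -> I (p * q).
Proof. by move=> [_ _ IM] Ip; rewrite mulrC; apply: IM. Qed.

Lemma ideal_sub_trans I p q r :
  is_ideal I -> I (p - q) -> I (q - r) -> I (p - r).
Proof. by move=> [_ ID _] Ipq Iqr; rewrite -(subrKA q); apply: ID. Qed.

Lemma ideal_bigsum I (S : Type) (r : seq S) (P : pred S) (F : S -> R) :
  is_ideal I -> (forall i, P i -> I (F i)) -> I (\sum_(i <- r | P i) F i).
Proof. by move=> [I0 ID _] IF; apply: (big_ind I). Qed.

Lemma ideal_congr I p q : is_ideal I -> I (p - q) -> I p <-> I q.
Proof.
move=> idI Ipq; have [_ ID _] := idI; split=> [Ip|Iq].
  by rewrite -[q](subKr p); apply: ideal_sub.
by rewrite -[p](subrK q); apply: ID.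
Qed.

Lemma zero_ideal : is_ideal (fun p : R => p = 0).
Proof. by split=> [//|a b -> ->|c a ->]; rewrite ?addr0 ?mulr0. Qed.

Lemma colon_ideal I p : is_ideal I -> is_ideal (colon I p).
Proof.
move=> [I0 ID IM]; split=> [|a b Ia Ib|c a Ia]; rewrite /colon ?mul0r //.
  by rewrite mulrDl; apply: ID.
by rewrite -mulrA; apply: IM.
Qed.

Lemma ideal_gen_ideal B : is_ideal (ideal_gen B).
Proof.
split=> [|_ _ [m [c [b [Bb ->]]]] [m' [c' [b' [Bb' ->]]]]|a _ [m [c [b [Bb ->]]]]].
- by exists 0%N, (fun=> 0), (fun=> 0); split=> [[]//|]; rewrite big_ord0.
- pose join (u : 'I_m -> R) (u' : 'I_m' -> R) k :=
    match split k with inl j => u j | inr j => u' j end.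
  exists (m + m')%N, (join c c'), (join b b'); split=> [k|].
    by rewrite /join; case: split.
  rewrite big_split_ord /join; congr (_ + _); apply: eq_bigr => k _.
    by rewrite (unsplitK (inl k)).
  by rewrite (unsplitK (inr k)).
- exists m, (fun k => a * c k), b; split=> //.
  by rewrite mulr_sumr; apply: eq_bigr => k _; rewrite mulrA.
Qed.

Lemma ideal_gen_mem B p : B p -> ideal_gen B p.
Proof.
by move=> Bp; exists 1%N, (fun=> 1), (fun=> p); rewrite big_ord1 mul1r.
Qed.

Lemma ideal_gen_min B I p :
  is_ideal I -> (forall q, B q -> I q) -> ideal_gen B p -> I p.
Proof.
move=> idI sBI [m [c [b [Bb ->]]]]; apply: ideal_bigsum => // k _.
by have [_ _ IM] := idI; apply/IM/sBI.
Qed.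

Lemma prime_bigprod I (S : eqType) (r : seq S) (P : pred S) (F : S -> R) :
  prime_ideal I -> I (\prod_(i <- r | P i) F i) ->
  exists2 i, P i & I (F i).
Proof.
move=> [_ I1 Ipr]; elim: r => [|i r IHr]; first by rewrite big_nil.
rewrite big_cons; case: ifP => // Pi /Ipr[IFi|/IHr//].
by exists i.
Qed.

End IdealTheory.

Lemma ideal_preim (R S : comNzRingType) (phi : {rmorphism R -> S}) (I : S -> Prop) :
  is_ideal I -> is_ideal (fun p => I (phi p)).
Proof.
move=> [I0 ID IM]; split=> [|a b Ia Ib|c a Ia]; rewrite ?rmorph0 //.
  by rewrite rmorphD; apply: ID.
by rewrite rmorphM; apply: IM.
Qed.

Lemma ker_ideal (R S : comNzRingType) (phi : {rmorphism R -> S}) :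
  is_ideal (fun p => phi p = 0).
Proof. exact: (ideal_preim phi (@zero_ideal S)). Qed.

Lemma ker_prime (R : comNzRingType) (S : idomainType) (phi : {rmorphism R -> S}) :
  prime_ideal (fun p => phi p = 0).
Proof.
split=> [||a b]; first exact: (ker_ideal phi).
  by rewrite rmorph1 => /eqP; rewrite oner_eq0.
by rewrite rmorphM => /eqP; rewrite mulf_eq0 => /orP[]/eqP ->; [left|right].
Qed.

(** * Polynomial induction, substitutions and homogeneous components *)

Section MPolyTools.
Variables (n : nat) (R : comNzRingType).

Lemma mpoly_ring_ind (P : {mpoly R[n]} -> Prop) :
    (forall c, P c%:MP) -> (forall i, P 'X_i) ->
    (forall p q, P p -> P q -> P (p + q)) ->
    (forall p q, P p -> P q -> P (p * q)) ->
  forall p, P p.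
Proof.
move=> PC PX PD PM p.
have P0 : P 0 by rewrite -(mpolyC0 n R); apply: PC.
have P1 : P 1 by rewrite -(mpolyC1 n R); apply: PC.
rewrite [p]mpolyE.
apply: (big_ind P P0 PD) => m _; rewrite -mul_mpolyC; apply: (PM) => //.
rewrite mpolyXE_id; apply: (big_ind P P1 PM) => i _.
by elim: (m i) => [|k IHk]; rewrite ?expr0 // exprS; apply: PM.
Qed.

Lemma mpoly_rmorph_eq (S : comNzRingType) (f g : {rmorphism {mpoly R[n]} -> S}) :
  (forall c, f c%:MP = g c%:MP) -> (forall i, f 'X_i = g 'X_i) -> f =1 g.
Proof.
move=> eqC eqX; apply: mpoly_ring_ind => // p q eqp eqq.
  by rewrite !rmorphD /= eqp eqq.
by rewrite !rmorphM /= eqp eqq.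
Qed.

Lemma mmapXU (S : comNzRingType) (f : {rmorphism R -> S}) (h : 'I_n -> S) i :
  mmap f h 'X_i = h i.
Proof. by rewrite mmapX mmap1U. Qed.

Lemma mpoly_pihomog_sum (p : {mpoly R[n]}) :
  p = \sum_(k < msize p) pihomog mdeg k p.
Proof. exact: pihomog_partitionE. Qed.

End MPolyTools.

(** Forms of degree [e] multiply the degree of every monomial by [e], and [0 < e] keeps distinct
    degrees distinct. Used with [e = 2] for the substitutions of [kernels] and with [e = 1] for
    inclusions of variables. *)
Lemma pihomog_subst (K : fieldType) n m (h : 'I_n -> {mpoly K[m]}) e k p :
    (0 < e)%N -> (forall i, h i \is e.-homog) ->
  pihomog mdeg (e * k)%N (mmap (@mpolyC m K) h p) =
    mmap (@mpolyC m K) h (pihomog mdeg k p).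
Proof.
move=> e_gt0 homh; elim/mpolyind: p => [|c t p _ _ IHp]; first by rewrite !raddf0.
rewrite !raddfD /= IHp; congr (_ + _).
rewrite linearZ /= !mmapZ !mul_mpolyC linearZ /=; congr (_ *: _).
have homt : mmap (@mpolyC m K) h 'X_[t] \is (e * mdeg t)%N.-homog.
  rewrite mmapX /mmap1 mdegE big_distrr /=.
  elim/big_ind2: _ => [|d1 p1 d2 p2|i _]; [exact: dhomog1| exact: dhomogM|].
  exact/dhomogMn/homh.
rewrite pihomogX; have [eq_tk|ne_tk] := eqVneq (mdeg t) k.
  by rewrite pihomog_dE // -eq_tk.
by rewrite rmorph0 (pihomog_ne0 _ homt) // eqn_pmul2l.
Qed.

(** * Finite intersections of kernels of substitutions *)

(** Degree 2 is that of the monomials u_C t_i and v_C t_i; sharing one degree makes [I] homogeneous.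
    The zero form is allowed, so variables may also be killed. *)
Definition kernels (K : fieldType) (N : nat) (I : {mpoly K[N]} -> Prop)
    (T : finType) (M : nat) (h : T -> 'I_N -> {mpoly K[M]}) : Prop :=
  (forall t i, h t i \is 2.-homog) /\
  (forall p, I p <-> forall t, mmap (@mpolyC M K) (h t) p = 0).

Section Kernels.
Variables (K : fieldType) (N : nat) (I : {mpoly K[N]} -> Prop).
Variables (T : finType) (M : nat) (h : T -> 'I_N -> {mpoly K[M]}).
Hypothesis kerI : kernels I h.
Implicit Types (p q f g : {mpoly K[N]}).

Local Notation phi t := (mmap (@mpolyC M K) (h t)).

Lemma kernels_ideal : is_ideal I.
Proof.
have [_ IE] := kerI; split=> [|a b /IE Ia /IE Ib|c a /IE Ia]; apply/IE => t.
- by rewrite rmorph0.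
- by rewrite rmorphD /= Ia Ib addr0.
- by rewrite rmorphM /= Ia mulr0.
Qed.

Lemma kernels_pihomog k p : I p -> I (pihomog mdeg k p).
Proof.
have [homh IE] := kerI => /IE Ip; apply/IE => t.
by rewrite -(@pihomog_subst _ _ _ _ 2) // Ip raddf0.
Qed.

(** Each kernel with [phi t f != 0] contains [P]. If none equals [P], choose in each an element
    outside [P]: their product multiplies [f] into [I], so it lies in the prime [P], a
    contradiction. *)
Lemma kernels_prime f P :
    prime_ideal P -> (forall g, colon I f g <-> P g) ->
  exists t, forall g, P g <-> phi t g = 0.
Proof.
move=> prP colP; have [_ IE] := kerI; have [_ P1 Ppr] := prP.
apply: NNPP => noker.
have sep t : phi t f != 0 -> exists g, phi t g = 0 /\ ~ P g.
  move=> nzf; apply: NNPP => nosep; apply: noker; exists t => g; split.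
    move/colP/IE/(_ t)/eqP; rewrite rmorphM /= mulf_eq0 (negPf nzf) orbF.
    by move/eqP.
  by move=> g0; apply: NNPP => nPg; apply: nosep; exists g.
have [s sP] : exists s : T -> {mpoly K[N]}, forall t,
    phi t f != 0 -> phi t (s t) = 0 /\ ~ P (s t).
  have {}sep t : exists g, phi t f != 0 -> phi t g = 0 /\ ~ P g.
    case: (boolP (phi t f != 0)) => [/sep[g gP]|_]; first by exists g.
    by exists 0.
  exists (fun t => proj1_sig (constructive_indefinite_description _ (sep t))) => t.
  by case: constructive_indefinite_description.
suff /colP/(prime_bigprod prP)[t /sP[]//] :
    colon I f (\prod_(t | phi t f != 0) s t) by [].
apply/IE => t; rewrite rmorphM /=.
have [->|nzf] := eqVneq (phi t f) 0; first by rewrite mulr0.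
by rewrite (bigD1 t) //= rmorphM /= (sP t nzf).1 !mul0r.
Qed.

(** An element outside [I] killed by as many [phi t] as possible has a single kernel as its colon
    ideal. Passing to a homogeneous component outside [I] keeps this maximality. *)
Lemma kernels_witness : ~ I 1 -> exists d, vnumber_witness I d.
Proof.
move=> I1; have [homh IE] := kerI; have [I0 ID IM] := kernels_ideal.
pose Z p := [set t | phi t p == 0].
have [p [nIp maxp]] : exists p, ~ I p /\ forall q, ~ I q -> (#|Z q| <= #|Z p|)%N.
  have bnd p : (#|Z p| <= #|T|)%N by apply: max_card.
  suff maxI k p : ~ I p -> (#|T| - #|Z p| <= k)%N ->
      exists p, ~ I p /\ forall q, ~ I q -> (#|Z q| <= #|Z p|)%N.
    exact: (maxI #|T| 1 I1 (leq_subr _ _)).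
  elim: k p => [|k IHk] p nIp; first rewrite leqn0 subn_eq0 => le_p.
    by exists p; split=> // q _; apply: leq_trans (bnd q) le_p.
  move=> le_p; case: (classic (exists2 q, ~ I q & (#|Z p| < #|Z q|)%N)).
    move=> [q nIq lt_pq]; apply: IHk nIq _.
    by rewrite -ltnS (leq_trans _ le_p) // ltn_sub2l // (leq_trans lt_pq).
  move=> nop; exists p; split=> // q nIq; rewrite leqNgt; apply/negP => lt_pq.
  by apply: nop; exists q.
have [k nIpk] : exists k, ~ I (pihomog mdeg k p).
  apply: NNPP => nok; apply: nIp; rewrite [p]mpoly_pihomog_sum.
  apply: ideal_bigsum kernels_ideal _ => k _.
  by apply: NNPP => nIk; apply: nok; exists k.
set f := pihomog mdeg k p in nIpk.
have maxf q : ~ I q -> (#|Z q| <= #|Z f|)%N.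
  move/maxp/leq_trans; apply; apply/subset_leq_card/subsetP => t.
  by rewrite !inE -(@pihomog_subst _ _ _ _ 2) // => /eqP ->; rewrite raddf0.
have [t nzf] : exists t, phi t f != 0.
  apply: NNPP => noz; apply: nIpk; apply/IE => t.
  by apply/eqP/negPn/negP => nzf; apply: noz; exists t.
have colonE g : colon I f g <-> phi t g = 0.
  split=> [/IE/(_ t)/eqP|g0].
    by rewrite rmorphM /= mulf_eq0 (negPf nzf) orbF => /eqP.
  (* Otherwise [g * f] lies outside [I] and vanishes at [t] in addition to all of [Z f], against
     maximality. *)
  apply: NNPP => nIgf.
  have sZ : Z f \subset Z (g * f).
    by apply/subsetP => s; rewrite !inE rmorphM => /eqP /= ->; rewrite mulr0.
  have /eqP eqZ : Z f == Z (g * f) by rewrite eqEcard sZ maxf.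
  have : t \in Z f by rewrite eqZ inE rmorphM /= g0 mul0r.
  by rewrite inE (negPf nzf).
exists k, f, (fun g => phi t g = 0); split=> //; first exact: pihomogP.
by split; [apply: ker_prime | exists f].
Qed.

End Kernels.

(** * Edge ideals as intersections of kernels *)

Lemma sum_leq_eq (S : finType) (P : pred S) (F G : S -> nat) i :
    (forall j, P j -> F j <= G j)%N ->
    (\sum_(j | P j) F j = \sum_(j | P j) G j)%N -> P i ->
  F i = G i.
Proof.
move=> leFG eqFG Pi; apply/eqP.
have /leqif_sum : forall j, P j -> (F j <= G j ?= iff (F j == G j))%N.
  by move=> j /leFG leFGj; split.
by case=> _; rewrite eqFG eqxx => /esym/forall_inP; apply.
Qed.

(** * Kernels of monomial maps *)

Section MonomialKernel.
Variables (K : fieldType) (N M : nat) (mu : 'I_N -> 'X_{1..M}).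

Definition monomial_image (a : 'X_{1..N}) : 'X_{1..M} :=
  (\sum_(k < N) mu k *+ a k)%MM.

Lemma monomial_imageD (a b : 'X_{1..N}) :
  monomial_image (a + b) = (monomial_image a + monomial_image b)%MM.
Proof.
apply/mnmP => l; rewrite mnmDE !mnm_sumE -big_split; apply: eq_bigr => k _.
by rewrite !mulmnE mnmDE mulnDr.
Qed.

Lemma monomial_imageU k : monomial_image U_(k) = mu k.
Proof.
apply/mnmP => l; rewrite mnm_sumE (bigD1 k) //= big1 => [|j ne_jk].
  by rewrite mulmnE mnm1E eqxx muln1 addn0.
by rewrite mulmnE mnm1E eq_sym (negPf ne_jk) muln0.
Qed.

Lemma mmap_monomial (a : 'X_{1..N}) :
  mmap (@mpolyC M K) (fun k => 'X_[mu k]) 'X_[a] = 'X_[monomial_image a].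
Proof. by rewrite mmapX /mmap1 mprodXnE. Qed.

(** The kernel is spanned by differences of monomials with equal image. Subtracting a multiple of
    one such difference shortens the support of [p], which drives the induction. *)
Lemma monomial_kernel (I : {mpoly K[N]} -> Prop) p :
    is_ideal I ->
    (forall a b, monomial_image a = monomial_image b -> I ('X_[a] - 'X_[b])) ->
  mmap (@mpolyC M K) (fun k => 'X_[mu k]) p = 0 -> I p.
Proof.
set phi := mmap _ _ => idI Ibin; have [I0 ID IM] := idI.
move: {2}(size (msupp p)) (leqnn (size (msupp p))) => s.
elim: s p => [|s IHs] p.
  by rewrite leqn0 size_eq0 msupp_eq0 => /eqP ->.
move=> le_ps p0; have [->//|nzp] := eqVneq p 0.
set a := mlead p; have a_p : a \in msupp p by apply: mlead_supp.
(* If the leading monomial [a] were alone over its image, the coefficient of that image in [phi p]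
   would be [p@_a], which is nonzero. *)
have [b [b_p ne_ba eq_mu]] : exists b,
    [/\ b \in msupp p, b != a & monomial_image b = monomial_image a].
  apply: NNPP => nob; move/(congr1 (mcoeff (monomial_image a))): (p0).
  have -> : phi p = \sum_(c <- msupp p) p@_c *: 'X_[monomial_image c].
    by apply: eq_bigr => c _; rewrite mul_mpolyC /mmap1 mprodXnE.
  rewrite raddf_sum mcoeff0 (bigD1_seq a) ?msupp_uniq //= mcoeffZ mcoeffX eqxx mulr1.
  rewrite big_seq_cond big1 => [|b /andP[b_p ne_ba]].
    by rewrite addr0 => /eqP; rewrite mcoeff_eq0 a_p.
  rewrite mcoeffZ mcoeffX.
  by case: eqP => [eq_mu|_]; rewrite ?mulr0 //; case: nob; exists b.
set q := p@_a *: ('X_[a] - 'X_[b]).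
have Iq : I q by rewrite /q -mul_mpolyC; apply/IM/Ibin.
rewrite -[p](subrK q); apply: ID => //; apply: IHs; last first.
  have -> : phi (p - q) = phi p - phi q by apply: raddfB.
  by rewrite p0 /q /phi mmapZ raddfB /= !mmap_monomial eq_mu subrr mulr0 subr0.
rewrite -ltnS (leq_trans _ le_ps) // (perm_size (perm_to_rem a_p)) /= ltnS.
apply: uniq_leq_size (msupp_uniq _) _ => c.
rewrite mem_rem_uniq ?msupp_uniq // !inE !mcoeff_msupp mcoeffB mcoeffZ mcoeffB !mcoeffX.
have [->|ne_ca] /= := eqVneq c a.
  by rewrite (negPf ne_ba) subr0 mulr1 subrr eqxx.
rewrite sub0r; have [<- _|_] := eqVneq b c.
  by rewrite -mcoeff_msupp.
by rewrite oppr0 mulr0 subr0.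
Qed.

End MonomialKernel.

(** * Ideals generated by edge binomials *)

Section EdgeIdeal.
Variables (K : fieldType) (m : nat).
Implicit Types (E : rel 'I_m) (i j v w : 'I_m).

Local Notation x := (@xvar K m).
Local Notation y := (@yvar K m).

Definition edge_binomial i j : {mpoly K[m + m]} := x i * y j - x j * y i.

(** An arbitrary relation is taken because [complete_nbhd] creates loops; their binomials are
    zero. *)
Definition edge_ideal E : {mpoly K[m + m]} -> Prop :=
  ideal_gen (fun p => exists i j, E i j /\ p = edge_binomial i j).

Lemma edge_ideal_is_ideal E : is_ideal (edge_ideal E).
Proof. exact: ideal_gen_ideal. Qed.

Lemma edge_ideal_mem E i j : E i j -> edge_ideal E (edge_binomial i j).
Proof. by move=> Eij; apply: ideal_gen_mem; exists i, j. Qed.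

Lemma edge_ideal_min E I p :
    is_ideal I -> (forall i j, E i j -> I (edge_binomial i j)) ->
  edge_ideal E p -> I p.
Proof. by move=> idI EI; apply: ideal_gen_min => // _ [i [j [/EI Ib ->]]]. Qed.

Lemma edge_ideal_sub E E' p :
  subrel E E' -> edge_ideal E p -> edge_ideal E' p.
Proof.
move=> sEE'; apply: edge_ideal_min (edge_ideal_is_ideal _) _ => i j /sEE'.
exact: edge_ideal_mem.
Qed.

Lemma binomial_edge_idealE (H : simple_graph m) p :
  binomial_edge_ideal K H p <-> edge_ideal H p.
Proof.
split; apply: (ideal_gen_min (@ideal_gen_ideal _ _)).
  by move=> _ [i [j [Hij _ ->]]]; apply: edge_ideal_mem.
move=> _ [i [j [Hij ->]]]; case: (ltngtP i j) => [lt_ij|lt_ji|/val_inj eq_ij].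
- by apply: ideal_gen_mem; exists i, j.
- rewrite -[edge_binomial _ _]opprK opprB.
  apply: (ideal_opp (@ideal_gen_ideal _ _)); apply: ideal_gen_mem.
  by exists j, i; rewrite edge_sym.
- by rewrite eq_ij edge_irr in Hij.
Qed.

Lemma edge_ideal_proper E : ~ edge_ideal E 1.
Proof.
pose ev := mmap (@idfun K) (fun _ : 'I_(m + m) => 0 : K).
have idev : is_ideal (fun p => ev p = 0).
  exact: (ker_ideal ev).
move/(edge_ideal_min idev) => ev1; have: ev 1 = 0.
  by apply: ev1 => i j _; rewrite /ev rmorphB !rmorphM /= !mmapXU !mul0r subrr.
by rewrite /ev rmorph1 => /eqP; rewrite oner_eq0.
Qed.

(** * Disjoint unions of cliques *)

Section Cliques.
Variables (E : rel 'I_m) (rep : 'I_m -> 'I_m).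
Hypothesis repE : forall i j, rep i = rep j <-> i = j \/ E i j.

(** These are the exponents of u_c t_i and v_c t_i with c = [rep i]; the 3m target variables are
    numbered u first, then v, then t. *)
Definition clique_exponent (k : 'I_(m + m)) : 'X_{1..m + (m + m)} :=
  match split k with
  | inl i => U_(lshift (m + m) (rep i)) + U_(rshift m (rshift m i))
  | inr i => U_(rshift m (lshift m (rep i))) + U_(rshift m (rshift m i))
  end%MM.

Local Notation mu := (monomial_image clique_exponent).

Lemma clique_exponent_x i : clique_exponent (lshift m i) =
  (U_(lshift (m + m) (rep i)) + U_(rshift m (rshift m i)))%MM.
Proof. by rewrite /clique_exponent (unsplitK (inl i)). Qed.

Lemma clique_exponent_y i : clique_exponent (rshift m i) =
  (U_(rshift m (lshift m (rep i))) + U_(rshift m (rshift m i)))%MM.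
Proof. by rewrite /clique_exponent (unsplitK (inr i)). Qed.

Lemma clique_exponent_class (a : 'X_{1..m + m}) c :
  mu a (lshift (m + m) c) = (\sum_(i | rep i == c) a (lshift m i))%N.
Proof.
rewrite mnm_sumE big_split_ord /= [X in (_ + X)%N]big1 ?addn0 => [|i _]; last first.
  by rewrite mulmnE clique_exponent_y mnmDE !mnm1E !eq_shift.
rewrite [RHS]big_mkcond; apply: eq_bigr => i _.
rewrite mulmnE clique_exponent_x mnmDE !mnm1E !eq_shift addn0.
by case: eqP; rewrite ?mul1n ?mul0n.
Qed.

Lemma clique_exponent_vertex (a : 'X_{1..m + m}) i :
  mu a (rshift m (rshift m i)) = (a (lshift m i) + a (rshift m i))%N.
Proof.
rewrite mnm_sumE big_split_ord /=.
rewrite (bigD1 i) //= [X in (_ + X + _)%N]big1 => [|j ne_ji]; last first.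
  by rewrite mulmnE clique_exponent_x mnmDE !mnm1E !eq_shift (negPf ne_ji).
rewrite addn0 (bigD1 i) //= [X in (_ + (_ + X))%N]big1 => [|j ne_ji]; last first.
  by rewrite mulmnE clique_exponent_y mnmDE !mnm1E !eq_shift (negPf ne_ji).
rewrite addn0 !mulmnE clique_exponent_x clique_exponent_y !mnmDE !mnm1E.
by rewrite !eq_shift eqxx !add0n !mul1n.
Qed.

(** Equal images mean equal x-degree in every class and equal total degree at every vertex. If [a]
    has more x_i than [b], some j in the class of i has less x_j, hence more y_j; trading x_i y_j
    for x_j y_i changes the monomial by a multiple of the edge binomial and lowers the excess of [a]
    over [b]. *)
Lemma clique_monomial_congr (a b : 'X_{1..m + m}) :
  mu a = mu b -> edge_ideal E ('X_[a] - 'X_[b]).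
Proof.
have [I0 ID IM] := edge_ideal_is_ideal E.
pose excess (a : 'X_{1..m + m}) := (\sum_i (a (lshift m i) - b (lshift m i)))%N.
move: {2}(excess a) (leqnn (excess a)) => s.
elim/ltn_ind: s a => s IHs a le_s eq_mu.
have class_sum i : (\sum_(j | rep j == rep i) a (lshift m j) =
    \sum_(j | rep j == rep i) b (lshift m j))%N.
  by rewrite -!clique_exponent_class eq_mu.
have vertex_sum i : (a (lshift m i) + a (rshift m i) =
    b (lshift m i) + b (rshift m i))%N.
  by rewrite -!clique_exponent_vertex eq_mu.
case: (boolP [exists i, b (lshift m i) < a (lshift m i)])%N => [/existsP[i lt_i]|].
  have [j eq_ij lt_j] : exists2 j, rep j == rep i & (a (lshift m j) < b (lshift m j))%N.
    apply/exists_inP; apply: contraLR lt_i => /exists_inPn le_class; rewrite -leqNgt.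
    rewrite -(@sum_leq_eq _ (fun j => rep j == rep i) (fun j => b (lshift m j))
      (fun j => a (lshift m j)) i) // => j /le_class.
    by rewrite -leqNgt.
  have [ne_ij Eij] : i != j /\ E i j.
    have ne_ij : i != j by apply: contraTneq lt_i => ->; rewrite -leqNgt ltnW.
    by split=> //; have /repE[/eqP|//] := esym (eqP eq_ij); rewrite (negPf ne_ij).
  set u := (U_(lshift m i) + U_(rshift m j))%MM.
  set v := (U_(lshift m j) + U_(rshift m i))%MM.
  have le_ua : (u <= a)%MM.
    have a_i : (0 < a (lshift m i))%N by apply: leq_ltn_trans lt_i.
    have a_j : (0 < a (rshift m j))%N.
      by rewrite -(ltn_add2l (a (lshift m j))) addn0 vertex_sum ltn_addr.
    apply/mnm_lepP => l; rewrite mnmDE !mnm1E.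
    by have [<-|_] := eqVneq (lshift m i) l; rewrite ?eq_shift //; case: eqP => // <-.
  set r := (a - u)%MM; have def_a : a = (r + u)%MM by rewrite submK.
  rewrite -[X in edge_ideal _ X](subrKA 'X_[(r + v)%MM]); apply: ID.
    rewrite {1}def_a !mpolyXD -mulrBr; apply: IM.
    exact: edge_ideal_mem.
  apply: (IHs (excess (r + v)%MM)) => //; last first.
    rewrite -eq_mu [in RHS]def_a !monomial_imageD !monomial_imageU.
    rewrite !clique_exponent_x !clique_exponent_y (eqP eq_ij).
    by congr (_ + _)%MM; apply/mnmP => l; rewrite !mnmDE; ring.
  apply: leq_trans le_s; rewrite /excess (bigD1 i) //= [X in (_ < X)%N](bigD1 i) //=.
  rewrite -addSn; apply: leq_add; last apply: leq_sum => l ne_li.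
    rewrite !mnmDE mnmBE mnmDE !mnm1E !eq_shift eqxx eq_sym (negPf ne_ij) !addn0.
    by rewrite -subSn ?subn1 ?prednK // ?(leq_ltn_trans _ lt_i) // -ltnS prednK //
      (leq_ltn_trans _ lt_i).
  rewrite !mnmDE mnmBE mnmDE !mnm1E !eq_shift eq_sym (negPf ne_li) !addn0 subn0.
  (* At j the exponent grows by one but remains at most that of [b], so its truncated difference
     stays 0. *)
  have [<-|_] := eqVneq j l; last by rewrite addn0.
  by rewrite addn1 (eqP lt_j).
rewrite negb_exists => /forallP le_ab.
suff -> : a = b by rewrite subrr.
(* With no excess, the x-exponents of [a] are bounded by those of [b] and have the same class sums,
   hence agree. *)
have eq_x i : a (lshift m i) = b (lshift m i).
  apply: (@sum_leq_eq _ (fun j => rep j == rep i) (fun j => a (lshift m j))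
    (fun j => b (lshift m j))) => // j _.
  by rewrite leqNgt.
apply/mnmP => l; rewrite -(splitK l); case: (split l) => i //=.
by apply/eqP; rewrite -(eqn_add2l (a (lshift m i))) vertex_sum eq_x.
Qed.

Lemma cliques_kernel p :
  edge_ideal E p <->
  mmap (@mpolyC _ K) (fun k => 'X_[clique_exponent k]) p = 0.
Proof.
split; last first.
  exact: (monomial_kernel (@edge_ideal_is_ideal E) clique_monomial_congr).
set phi := mmap _ _; apply: (@edge_ideal_min E (fun q => phi q = 0) p (ker_ideal phi)).
move=> i j Eij; have eq_ij : rep i = rep j by apply/repE; right.
rewrite /phi rmorphB !rmorphM /= !mmapXU !clique_exponent_x !clique_exponent_y.
by rewrite !mpolyXD eq_ij; ring.
Qed.

End Cliques.

(** The case i = j is included, so the neighbours of a simplicial vertex carry loops. For symmetric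
    [E], all vertices being simplicial is then exactly transitivity. *)
Definition simplicial E w := [forall i, forall j, E w i && E w j ==> E i j].

Lemma simplicialP E w :
  reflect (forall i j, E w i -> E w j -> E i j) (simplicial E w).
Proof.
apply: (iffP forallP) => [sw i j Ei Ej|sw i].
  by have /forallP/(_ j)/implyP := sw i; apply; rewrite Ei Ej.
by apply/forallP => j; apply/implyP => /andP[]; apply: sw.
Qed.

(** The vertex remains as an isolated index, so the polynomial ring does not change. *)
Definition delete_vertex v E : rel 'I_m :=
  fun i j => [&& E i j, i != v & j != v].

Definition complete_nbhd v E : rel 'I_m :=
  fun i j => E i j || (E v i && E v j).

Definition kill_vertex v (k : 'I_(m + m)) : {mpoly K[m + m]} :=
  match split k with
  | inl i => if i == v then 0 else x i
  | inr i => if i == v then 0 else y i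
  end.

(** * Splitting at a vertex: deletion and completion of its neighbourhood *)

Section Split.
Variables (E : rel 'I_m) (v : 'I_m).
Hypothesis symE : ssrbool.symmetric E.

Local Notation kappa := (mmap (@mpolyC _ K) (kill_vertex v)).

Lemma kill_vertex_x i : kappa (x i) = if i == v then 0 else x i.
Proof. by rewrite mmapXU /kill_vertex (unsplitK (inl i)). Qed.

Lemma kill_vertex_y i : kappa (y i) = if i == v then 0 else y i.
Proof. by rewrite mmapXU /kill_vertex (unsplitK (inr i)). Qed.

Lemma kill_vertex_binomial i j : kappa (edge_binomial i j) =
  if (i == v) || (j == v) then 0 else edge_binomial i j.
Proof.
rewrite rmorphB !rmorphM /= !kill_vertex_x !kill_vertex_y.
by case: eqP; case: eqP; rewrite ?mul0r ?mulr0 ?subrr.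
Qed.

(* For neighbours i, j of v, both x_v and y_v carry the binomial of {i, j} into
   the edge ideal, so only the coefficients free of x_v, y_v matter. *)
Lemma kill_vertex_sub c i j :
  E v i -> E v j -> edge_ideal E ((c - kappa c) * edge_binomial i j).
Proof.
move=> Evi Evj; have [I0 ID IM] := edge_ideal_is_ideal E.
have Ei := edge_ideal_mem Evi; have Ej := edge_ideal_mem Evj.
have xv_mem : edge_ideal E (x v * edge_binomial i j).
  have -> : x v * edge_binomial i j =
      x i * edge_binomial v j - x j * edge_binomial v i.
    by rewrite /edge_binomial; ring.
  by apply: (ideal_sub (edge_ideal_is_ideal E)); apply: IM.
have yv_mem : edge_ideal E (y v * edge_binomial i j).
  have -> : y v * edge_binomial i j =
      y i * edge_binomial v j - y j * edge_binomial v i.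
    by rewrite /edge_binomial; ring.
  by apply: (ideal_sub (edge_ideal_is_ideal E)); apply: IM.
elim/mpoly_ring_ind: c => [c|k|p q Ip Iq|p q Ip Iq].
- by rewrite mmapC subrr mul0r.
- rewrite mmapXU /kill_vertex -{1}(splitK k).
  case: (split k) => l /=; have [->|_] := eqVneq l v;
    by rewrite ?subr0 ?subrr ?mul0r.
- rewrite rmorphD /= opprD addrACA mulrDl; exact: (ID _ _ Ip Iq).
- have -> : (p * q - kappa (p * q)) * edge_binomial i j =
      p * ((q - kappa q) * edge_binomial i j) +
      kappa q * ((p - kappa p) * edge_binomial i j).
    by rewrite rmorphM /=; ring.
  exact: (ID _ _ (IM _ _ Iq) (IM _ _ Ip)).
Qed.

(** For the converse, [kappa p] already lies in the edge ideal of [E], so it remains to put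
    [p - kappa p] there. This is checked term by term on an expression of [p] by binomials of the
    completed graph. *)
Lemma edge_ideal_split p :
  edge_ideal E p <->
  edge_ideal (delete_vertex v E) (kappa p) /\ edge_ideal (complete_nbhd v E) p.
Proof.
have [I0 ID IM] := edge_ideal_is_ideal E.
have delE q : edge_ideal (delete_vertex v E) q -> edge_ideal E q.
  by apply: edge_ideal_sub => i j /andP[].
split=> [Ep|[Ep]].
  split; last by apply: edge_ideal_sub Ep => i j Eij; rewrite /complete_nbhd Eij.
  have id_preim := ideal_preim kappa (edge_ideal_is_ideal (delete_vertex v E)).
  apply: (edge_ideal_min id_preim _ Ep) => i j Eij; rewrite /= kill_vertex_binomial.
  case: ifPn => [_|]; first by have [] := edge_ideal_is_ideal (delete_vertex v E).
  by rewrite negb_or => ne; apply: edge_ideal_mem; rewrite /delete_vertex Eij.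
move=> [r [c [b [bE def_p]]]].
suff sub_p : edge_ideal E (p - kappa p).
  by apply/(ideal_congr (edge_ideal_is_ideal E) sub_p)/delE.
rewrite def_p rmorph_sum -sumrB; apply: ideal_bigsum (edge_ideal_is_ideal E) _.
move=> k _; have [i [j [Eij ->]]] := bE k; rewrite rmorphM /= kill_vertex_binomial.
case: (boolP (E i j)) => [{}Eij|nEij].
  apply: (ideal_sub (edge_ideal_is_ideal E)); first exact/IM/edge_ideal_mem.
  apply: IM; case: ifP => // _; exact: edge_ideal_mem.
move: Eij; rewrite /complete_nbhd (negPf nEij) /= => /andP[Evi Evj].
(* A pair joined only by the completion avoids [v], since otherwise it would be an edge of [E]. So
   [kappa] fixes its binomial and [kill_vertex_sub] applies. *)
rewrite ifN; first by rewrite -mulrBl; apply: kill_vertex_sub.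
rewrite negb_or; apply/andP; split; apply: contraNneq nEij => eq_v.
  by rewrite eq_v.
by rewrite eq_v symE.
Qed.

Lemma delete_vertex_sym : ssrbool.symmetric (delete_vertex v E).
Proof. by move=> i j; rewrite /delete_vertex symE [(i != v) && _]andbC. Qed.

Lemma complete_nbhd_sym : ssrbool.symmetric (complete_nbhd v E).
Proof. by move=> i j; rewrite /complete_nbhd symE [E v i && _]andbC. Qed.

Lemma delete_vertex_simplicial w :
  (w == v) || simplicial E w -> simplicial (delete_vertex v E) w.
Proof.
move=> sw; apply/simplicialP => i j /and3P[Ewi ne_wv ne_iv] /and3P[Ewj _ ne_jv].
move: sw; rewrite (negPf ne_wv) => /simplicialP/(_ i j Ewi Ewj) Eij.
exact/and3P.
Qed.

(** A simplicial [w] adjacent to [v] has all its neighbours, old or new, in the neighbourhood of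
    [v], which is now complete. A vertex not adjacent to [v] gains no neighbour. *)
Lemma complete_nbhd_simplicial w :
  (w == v) || simplicial E w -> simplicial (complete_nbhd v E) w.
Proof.
move=> /predU1P[->|/simplicialP sw]; apply/simplicialP => i j; rewrite /complete_nbhd.
  have nbhd k : E v k || E v v && E v k -> E v k by case/orP => // /andP[].
  by move=> /nbhd -> /nbhd ->; rewrite orbT.
move=> /orP[Ewi|/andP[Evw Evi]] /orP[Ewj|/andP[Evw' Evj]].
- by rewrite sw.
- by rewrite Evj [E v i](sw v) ?orbT // symE.
- by rewrite Evi [E v j](sw v) ?orbT // symE.
- by rewrite Evi Evj orbT.
Qed.

End Split.

Lemma simplicial_cliques E :
    ssrbool.symmetric E -> (forall w, simplicial E w) ->
  exists rep : 'I_m -> 'I_m, forall i j, rep i = rep j <-> i = j \/ E i j.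
Proof.
move=> symE simpE.
have trE i j k : E i j -> E j k -> E i k.
  by move=> Eij; apply: (simplicialP _ _ (simpE j)); rewrite symE.
(* The picked neighbour depends only on the neighbourhood, which is shared along a class; an
   isolated vertex defaults to itself. *)
exists (fun i => odflt i [pick j | E i j]) => i j; split; last first.
  move=> [->//|Eij]; rewrite (@eq_pick _ (E i) (E j)) => [|k].
    case: pickP => // /(_ i) /idP[]; by rewrite symE.
  by apply/idP/idP => [|/(trE _ _ _ Eij)//]; apply: trE; rewrite symE.
case: pickP => [k Eik|Ni]; case: pickP => [l Ejl|Nj] /= eq_r.
- by right; apply: trE Eik _; rewrite eq_r symE.
- by have := Nj i; rewrite symE -eq_r Eik.
- by have := Ni j; rewrite symE eq_r Ejl.
- by left.
Qed.

(** Induction on the number of nonsimplicial vertices. Splitting at such a vertex makes it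
    simplicial on both sides and keeps simplicial vertices so; when none is left, a single clique
    map suffices. *)
Theorem edge_ideal_kernels E :
    ssrbool.symmetric E ->
  exists (T : finType) (h : T -> 'I_(m + m) -> {mpoly K[m + (m + m)]}),
    kernels (edge_ideal E) h.
Proof.
move: {2}#|[pred w | ~~ simplicial E w]|
  (leqnn #|[pred w | ~~ simplicial E w]|) => s.
elim: s E => [|s IHs] E le_s symE.
  have [|rep repE] := simplicial_cliques symE.
    move=> w; apply/negPn; move: le_s; rewrite leqn0 => /eqP/card0_eq/(_ w).
    by rewrite inE => ->.
  exists unit, (fun _ k => 'X_[clique_exponent rep k]); split=> [_ k|p].
    rewrite dhomogX /clique_exponent.
    by case: split => i; rewrite /= mdegD !mdeg1.
  rewrite (cliques_kernel repE); split=> [? _|]; [by []|exact].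
have [/forallP simpE|] := boolP [forall w, simplicial E w].
  apply: IHs => //; rewrite (_ : #|_| = 0%N) //.
  by apply/eqP/pred0P => w /=; rewrite simpE.
rewrite negb_forall => /existsP[v nsv].
have smaller (E' : rel 'I_m) :
    (forall w, (w == v) || simplicial E w -> simplicial E' w) ->
    (#|[pred w | ~~ simplicial E' w]| <= s)%N.
  move=> sEE'; rewrite -ltnS (leq_trans _ le_s) //; apply/proper_card/properP.
  split; last by exists v; rewrite ?inE // sEE' ?eqxx.
  by apply/subsetP => w; rewrite !inE; apply: contraNN => sw; rewrite sEE' ?sw ?orbT.
have [T1 [h1 [hom1 ker1]]] := IHs _ (smaller _ (delete_vertex_simplicial (v := v)))
  (delete_vertex_sym v symE).
have [T2 [h2 [hom2 ker2]]] := IHs _ (smaller _ (complete_nbhd_simplicial symE))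
  (complete_nbhd_sym v symE).
pose kh t := fun k => mmap (@mpolyC _ K) (h1 t) (kill_vertex v k).
exists (T1 + T2)%type, (fun t => match t with inl t => kh t | inr t => h2 t end).
have homkh t k : kh t k \is 2.-homog.
  rewrite /kh /kill_vertex; case: split => i; case: ifP => _; rewrite ?mmapXU ?rmorph0 ?dhomog0 //.
split=> [[t|t] k //|p]; rewrite (edge_ideal_split v symE) ker1 ker2.
have khE t q : mmap (@mpolyC _ K) (kh t) q =
    mmap (@mpolyC _ K) (h1 t) (mmap (@mpolyC _ K) (kill_vertex v) q).
  pose f := mmap (@mpolyC _ K) (h1 t) \o mmap (@mpolyC _ K) (kill_vertex v).
  apply: (@mpoly_rmorph_eq _ _ _ (mmap (@mpolyC _ K) (kh t)) f) => [c|k].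
    by rewrite /= !mmapC.
  by rewrite /= !mmapXU.
split=> [[p1 p2] [t|t]|p0]; rewrite ?khE //.
by split=> t; [rewrite -khE; apply: (p0 (inl t))|apply: (p0 (inr t))].
Qed.

End EdgeIdeal.

(** * Ideals in disjoint sets of variables *)

Definition independent_mod (K : fieldType) (N : nat) (A : finType)
    (I : {mpoly K[N]} -> Prop) (D : {set A}) (u : A -> {mpoly K[N]}) : Prop :=
  forall c : A -> K, I (\sum_(a in D) c a *: u a) -> forall a, a \in D -> c a = 0.

Lemma independent_mod_notin (K : fieldType) (N : nat) (A : finType)
    (I : {mpoly K[N]} -> Prop) (D : {set A}) (u : A -> {mpoly K[N]}) a :
  independent_mod I D u -> a \in D -> ~ I (u a).
Proof.
move=> indep aD Iua; have sumE : \sum_(b in D) (b == a)%:R *: u b = u a.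
  rewrite (bigD1 a) //= eqxx scale1r big1 ?addr0 // => b /andP[_ /negPf ->].
  by rewrite scale0r.
move/(_ (fun b => (b == a)%:R)): indep; rewrite sumE => /(_ Iua a aD)/eqP.
by rewrite eqxx oner_eq0.
Qed.

(** * Reduction of sums of products to independent factors *)

Section Elimination.
Variables (K : fieldType) (N1 N2 N : nat).
Variables (g1 : 'I_N1 -> {mpoly K[N]}) (g2 : 'I_N2 -> {mpoly K[N]}).
Variables (I1 : {mpoly K[N1]} -> Prop) (I : {mpoly K[N]} -> Prop).
Variables (A : finType) (lab : A -> nat) (V2 : nat -> {mpoly K[N2]} -> Prop).

Local Notation f1 := (mmap (@mpolyC N K) g1).
Local Notation f2 := (mmap (@mpolyC N K) g2).

Hypothesis idI : is_ideal I.
Hypothesis sI1 : forall p, I1 p -> I (f1 p).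
Hypothesis V2P : forall k c p q, V2 k p -> V2 k q -> V2 k (p + c *: q).

(* If u_b is a combination of the other u_a modulo I1, then the term of index b
   is absorbed into the h_a. *)
Lemma eliminate_term (D : {set A}) u h c b :
    (forall a, a \in D -> V2 (lab a) (h a)) ->
    I1 (\sum_(a in D | lab a == lab b) c a *: u a) -> b \in D -> c b != 0 ->
  exists h', (forall a, a \in D -> V2 (lab a) (h' a)) /\
    I (\sum_(a in D) f1 (u a) * f2 (h a)
       - \sum_(a in D :\ b) f1 (u a) * f2 (h' a)).
Proof.
move=> Vh Iu bD nz_cb.
(* Solving the relation for [u b] involves only terms with the label of [b], so subtracting
   multiples of [h b] keeps each [h a] in its own [V2 (lab a)]. *)
pose c' a := if lab a == lab b then c a / c b else 0.
exists (fun a => h a - c' a *: h b); split=> [a aD|].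
  rewrite -scaleNr /c'; case: eqP => [eq_ab|_].
    by apply: V2P; [apply: Vh | rewrite eq_ab; apply: Vh].
  by rewrite oppr0 scale0r addr0; apply: Vh.
have -> : \sum_(a in D) f1 (u a) * f2 (h a) -
    \sum_(a in D :\ b) f1 (u a) * f2 (h a - c' a *: h b) =
    (c b)^-1%:MP * f2 (h b) * f1 (\sum_(a in D | lab a == lab b) c a *: u a).
  rewrite (big_setD1 b) //= -addrA -sumrB.
  rewrite rmorph_sum big_mkcondr /= [X in _ = _ * X](big_setD1 b) //= eqxx.
  rewrite mulrDr [X in _ = _ + X]mulr_sumr.
  congr (_ + _).
    rewrite mmapZ; set F := f2 _; set G := f1 _.
    by rewrite mulrACA -mpolyCM mulVf // mpolyC1 mul1r mulrC.
  apply: eq_bigr => a _; rewrite rmorphB /= mulrBr subKr mmapZ /c'.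
  case: eqP => _ /=; last by rewrite mpolyC0 mul0r !mulr0.
  by rewrite mmapZ /= mpolyCM; ring.
by have [_ _ IM] := idI; apply/IM/sI1.
Qed.

End Elimination.

Lemma not_independent_mod (K : fieldType) (N : nat) (A : finType)
    (I : {mpoly K[N]} -> Prop) (D : {set A}) (u : A -> {mpoly K[N]}) :
  ~ independent_mod I D u ->
  exists c b, [/\ I (\sum_(a in D) c a *: u a), b \in D & c b != 0].
Proof.
move=> dep; apply: NNPP => nocb; apply: dep => c Ic b bD.
by apply/eqP/negPn/negP => nz; apply: nocb; exists c, b.
Qed.

Section Representation.
Variables (K : fieldType) (N1 N2 N : nat).
Variables (g1 : 'I_N1 -> {mpoly K[N]}) (g2 : 'I_N2 -> {mpoly K[N]}).
Variables (I1 : {mpoly K[N1]} -> Prop) (I2 : {mpoly K[N2]} -> Prop).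
Variables (I : {mpoly K[N]} -> Prop) (A : finType) (lab : A -> nat).
Variables (V1 : nat -> {mpoly K[N1]} -> Prop) (V2 : nat -> {mpoly K[N2]} -> Prop).
Implicit Types (D : {set A}) (u : A -> {mpoly K[N1]}) (h : A -> {mpoly K[N2]}).

Local Notation f1 := (mmap (@mpolyC N K) g1).
Local Notation f2 := (mmap (@mpolyC N K) g2).

(** Each label carries a space of admissible factors, and a relation modulo [J] splits by labels.
    This lets terms be eliminated without leaving their degree. *)
Definition graded_by (n : nat) (V : nat -> {mpoly K[n]} -> Prop)
    (J : {mpoly K[n]} -> Prop) : Prop :=
  (forall k c p q, V k p -> V k q -> V k (p + c *: q)) /\
  (forall D (w : A -> {mpoly K[n]}) (c : A -> K) j,
    (forall a, a \in D -> V (lab a) (w a)) -> J (\sum_(a in D) c a *: w a) ->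
    J (\sum_(a in D | lab a == j) c a *: w a)).

Hypothesis idI : is_ideal I.
Hypothesis sI1 : forall p, I1 p -> I (f1 p).
Hypothesis sI2 : forall p, I2 p -> I (f2 p).
Hypothesis gradI1 : graded_by V1 I1.
Hypothesis gradI2 : graded_by V2 I2.

(** While one family is dependent modulo its ideal, [eliminate_term] removes an index and absorbs
    its term into the other family; the size of [D] falls. *)
Lemma independent_representation D u h :
    (forall a, a \in D -> V1 (lab a) (u a)) ->
    (forall a, a \in D -> V2 (lab a) (h a)) ->
  exists (D' : {set A}) u' h',
    [/\ forall a, a \in D' -> V1 (lab a) (u' a) /\ V2 (lab a) (h' a),
        I (\sum_(a in D) f1 (u a) * f2 (h a) - \sum_(a in D') f1 (u' a) * f2 (h' a)),
        independent_mod I1 D' u' & independent_mod I2 D' h'].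
Proof.
have [I0 ID _] := idI.
move: {2}#|D| (leqnn #|D|) => s; elim: s D u h => [|s IHs] D u h.
  rewrite leqn0 cards_eq0 => /eqP -> _ _; exists set0, u, h; split.
  - by move=> a; rewrite inE.
  - by rewrite subrr.
  - by move=> c _ a; rewrite inE.
  - by move=> c _ a; rewrite inE.
move=> le_D Vu Vh.
have sDb b a : a \in D :\ b -> a \in D by case/setD1P.
have smaller b : b \in D -> (#|D :\ b| <= s)%N.
  by move=> bD; move: le_D; rewrite (cardsD1 b) bD.
case: (classic (independent_mod I1 D u)) => [indu|/not_independent_mod[c [b [Iu bD nz]]]].
  case: (classic (independent_mod I2 D h)) => [indh|/not_independent_mod[c [b [Ih bD nz]]]].
    exists D, u, h; split; rewrite ?subrr // => a aD.
    by split; [apply: Vu | apply: Vh].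
  have [u' [Vu' Iu']] := eliminate_term g1 idI sI2 gradI1.1 Vu (gradI2.2 _ _ _ _ Vh Ih) bD nz.
  have [||D' [u'' [h'' [V'' I'' i1 i2]]]] := IHs (D :\ b) u' h (smaller b bD).
  - by move=> a /sDb; apply: Vu'.
  - by move=> a /sDb; apply: Vh.
  exists D', u'', h''; split; [exact: V'' | | exact: i1 | exact: i2].
  apply: ideal_sub_trans idI _ I''; move: Iu'.
  congr (I (_ - _)); apply: eq_bigr => a _; exact: mulrC.
have [h' [Vh' Ih']] := eliminate_term g2 idI sI1 gradI2.1 Vh (gradI1.2 _ _ _ _ Vu Iu) bD nz.
have [||D' [u'' [h'' [V'' I'' i1 i2]]]] := IHs (D :\ b) u h' (smaller b bD).
- by move=> a /sDb; apply: Vu.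
- by move=> a /sDb; apply: Vh'.
exists D', u'', h''; split; [exact: V'' | | exact: i1 | exact: i2].
exact: ideal_sub_trans idI Ih' I''.
Qed.

End Representation.

Lemma graded_by_trivial (K : fieldType) (A : finType) n (J : {mpoly K[n]} -> Prop) :
  is_ideal J -> @graded_by K A (fun=> 0%N) n (fun _ _ => True) J.
Proof.
move=> [J0 _ _]; split=> // D w c j _ Jw; case: j => [|j].
  by rewrite (eq_bigl (mem D)) // => a; rewrite eqxx andbT.
by rewrite big_pred0 // => a; rewrite andbF.
Qed.

(** Distinct labels have distinct degrees, so the terms labelled [j] are picked out by one
    homogeneous component. [P] restricts the labels because the truncated difference d - k is
    injective only for k up to d. *)
Lemma graded_by_homog (K : fieldType) (A : finType) (lab : A -> nat) n
    (J : {mpoly K[n]} -> Prop) (P : nat -> Prop) (deg : nat -> nat) :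
    (forall k p, J p -> J (pihomog mdeg k p)) ->
    (forall i j, P i -> P j -> deg i = deg j -> i = j) -> is_ideal J ->
  graded_by lab (fun k p => P k /\ p \is (deg k).-homog) J.
Proof.
move=> homJ degI [J0 _ _]; split=> [k c p q [Pk homp] [_ homq]|D w c j Vw Jw].
  by split=> //; rewrite rpredD ?dhomogZ.
case: (classic (exists2 a, a \in D & lab a = j)) => [[b bD eq_bj]|noj]; last first.
  rewrite big_pred0 // => a; apply/negP => /andP[aD /eqP eq_aj].
  by apply: noj; exists a.
have Pj : P j by rewrite -eq_bj; have [] := Vw b bD.
move/(homJ (deg j)): Jw; rewrite raddf_sum big_mkcondr /=; congr J.
apply: eq_bigr => a aD; have [Pa homa] := Vw a aD; rewrite linearZ /=.
have [eq_aj|ne_aj] := eqVneq (lab a) j; first by rewrite pihomog_dE // -eq_aj.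
rewrite (pihomog_ne0 _ homa) ?scaler0 //.
by apply: contra_neq ne_aj; apply: degI.
Qed.

(** [s] tells the block of each variable and inverts the map assembled from [e1] and [e2]. *)
Definition split_variables N1 N2 N (e1 : 'I_N1 -> 'I_N) (e2 : 'I_N2 -> 'I_N)
    (s : 'I_N -> 'I_N1 + 'I_N2) : Prop :=
  [/\ forall i, s (e1 i) = inl i, forall i, s (e2 i) = inr i &
      forall k, k = match s k with inl i => e1 i | inr i => e2 i end].

Lemma split_variables_sym N1 N2 N (e1 : 'I_N1 -> 'I_N) (e2 : 'I_N2 -> 'I_N) s :
  split_variables e1 e2 s ->
  split_variables e2 e1 (fun k => match s k with inl i => inr i | inr i => inl i end).
Proof.
move=> [se1 se2 sK]; split=> [i|i|k]; rewrite ?se1 ?se2 //.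
by rewrite {1}[k]sK; case: (s k).
Qed.

Definition glue_ideal (K : fieldType) N1 N2 N (e1 : 'I_N1 -> 'I_N)
    (e2 : 'I_N2 -> 'I_N) (I1 : {mpoly K[N1]} -> Prop) (I2 : {mpoly K[N2]} -> Prop) :
    {mpoly K[N]} -> Prop :=
  ideal_gen (fun q =>
    (exists2 p, I1 p & q = mmap (@mpolyC N K) (fun i => 'X_(e1 i)) p) \/
    (exists2 p, I2 p & q = mmap (@mpolyC N K) (fun i => 'X_(e2 i)) p)).

Lemma glue_ideal_sym (K : fieldType) N1 N2 N (e1 : 'I_N1 -> 'I_N)
    (e2 : 'I_N2 -> 'I_N) (I1 : {mpoly K[N1]} -> Prop) (I2 : {mpoly K[N2]} -> Prop) p :
  glue_ideal e1 e2 I1 I2 p -> glue_ideal e2 e1 I2 I1 p.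
Proof.
apply: (ideal_gen_min (@ideal_gen_ideal _ _)) => q [qI|qI]; apply: ideal_gen_mem.
  by right.
by left.
Qed.

(** * Coefficients in the second block of variables *)

Section Coefficients.
Variables (K : fieldType) (N1 N2 N M : nat).
Variables (e1 : 'I_N1 -> 'I_N) (e2 : 'I_N2 -> 'I_N) (s : 'I_N -> 'I_N1 + 'I_N2).
Hypothesis splitP : split_variables e1 e2 s.
Variable h1 : 'I_N1 -> {mpoly K[M]}.

Local Notation iota1 := (mmap (@mpolyC N K) (fun i => 'X_(e1 i))).
Local Notation iota2 := (mmap (@mpolyC N K) (fun i => 'X_(e2 i))).
Local Notation phi1 := (mmap (@mpolyC M K) h1).

(* The base change of [phi1] to the polynomial ring in the second block of
   variables. *)
Definition glue_map : {mpoly K[N]} -> {mpoly {mpoly K[N2]}[M]} :=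
  mmap (@mpolyC M {mpoly K[N2]} \o @mpolyC N2 K)
    (fun k => match s k with
              | inl i => map_mpoly (@mpolyC N2 K) (h1 i)
              | inr i => ('X_i)%:MP
              end).

HB.instance Definition _ := GRing.RMorphism.on glue_map.

Lemma glue_map1 u : glue_map (iota1 u) = map_mpoly (@mpolyC N2 K) (phi1 u).
Proof.
have [se1 _ _] := splitP.
apply: (@mpoly_rmorph_eq _ _ _ (glue_map \o iota1)
  (map_mpoly (@mpolyC N2 K) \o phi1)) => [c|i] /=.
  by rewrite !mmapC map_mpolyC /glue_map mmapC.
by rewrite !mmapXU /glue_map mmapXU se1.
Qed.

Lemma glue_map2 v : glue_map (iota2 v) = v%:MP.
Proof.
have [_ se2 _] := splitP.
apply: (@mpoly_rmorph_eq _ _ _ (glue_map \o iota2) (@mpolyC M _)) => [c|i] /=.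
  by rewrite mmapC /glue_map mmapC.
by rewrite mmapXU /glue_map mmapXU se2.
Qed.

Lemma glue_map_coeff u v z :
  (glue_map (iota1 u * iota2 v))@_z = (phi1 u)@_z *: v.
Proof.
rewrite rmorphM /= glue_map1 glue_map2 mulrC mcoeffCM mcoeff_map_mpoly mulrC.
by rewrite mul_mpolyC.
Qed.

(** Polynomials whose image has all coefficients in [I2] form an ideal. It contains the generators:
    those from [I1] map to 0, those from [I2] to constants. *)
Lemma glue_map_ideal I1 I2 g z :
    is_ideal I2 -> (forall p, I1 p -> phi1 p = 0) ->
  glue_ideal e1 e2 I1 I2 g -> I2 (glue_map g)@_z.
Proof.
move=> idI2 I1_0; have [I20 ID2 IM2] := idI2.
move=> gI; move: z.
have idz : is_ideal (fun q => forall z, I2 (glue_map q)@_z).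
  split=> [z|a b Ia Ib z|c a Ia z].
  - by rewrite rmorph0 mcoeff0.
  - by rewrite rmorphD mcoeffD; apply: (ID2 _ _ (Ia z) (Ib z)).
  - rewrite rmorphM mcoeffM; apply: ideal_bigsum idI2 _ => k _.
    exact: (IM2 _ _ (Ia _)).
apply: (ideal_gen_min idz _ gI) => _ [[p Ip ->]|[p Ip ->]] z.
  by rewrite glue_map1 I1_0 // rmorph0 mcoeff0.
by rewrite glue_map2 mcoeffC mulrC; case: eqP; rewrite ?mul1r ?mul0r.
Qed.

(** Modulo [I2], each coefficient of the image is a relation among the [v a] whose scalars are
    coefficients of the [phi1 (u a)]; independence makes these vanish. *)
Lemma glue_map_independent (A : finType) (D : {set A}) u v I2 :
    (forall z, I2 (glue_map (\sum_(a in D) iota1 (u a) * iota2 (v a)))@_z) ->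
    independent_mod I2 D v ->
  forall a, a \in D -> phi1 (u a) = 0.
Proof.
move=> Isum indep a aD; apply/mpolyP => z; rewrite mcoeff0.
apply: (indep (fun b => (phi1 (u b))@_z)) aD.
move: (Isum z); congr I2; rewrite rmorph_sum raddf_sum /=.
by apply: eq_bigr => b _; rewrite glue_map_coeff.
Qed.

End Coefficients.

Section Glue.
Variables (K : fieldType) (N1 N2 N : nat).
Variables (e1 : 'I_N1 -> 'I_N) (e2 : 'I_N2 -> 'I_N) (s : 'I_N -> 'I_N1 + 'I_N2).
Hypothesis splitP : split_variables e1 e2 s.

Local Notation iota1 := (mmap (@mpolyC N K) (fun i => 'X_(e1 i))).
Local Notation iota2 := (mmap (@mpolyC N K) (fun i => 'X_(e2 i))).

Lemma big_split_variables (R : Type) (idx : R) (op : Monoid.com_law idx) (F : 'I_N -> R) :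
  \big[op/idx]_k F k = op (\big[op/idx]_i F (e1 i)) (\big[op/idx]_i F (e2 i)).
Proof.
have [se1 se2 sK] := splitP.
pose e k := match k with inl i => e1 i | inr i => e2 i end.
have bij_e : bijective e.
  by exists s => [[i|i]|k] /=; rewrite ?se1 ?se2 // -[RHS]sK.
by rewrite (reindex e) ?big_sumType //; apply: onW_bij.
Qed.

Definition mnm_restrict n (e : 'I_n -> 'I_N) (m : 'X_{1..N}) : 'X_{1..n} :=
  [multinom m (e i) | i < n].

Lemma mdeg_split m :
  mdeg m = (mdeg (mnm_restrict e1 m) + mdeg (mnm_restrict e2 m))%N.
Proof.
rewrite !mdegE big_split_variables.
by congr (_ + _)%N; apply: eq_bigr => i _; rewrite mnmE.
Qed.

Lemma mpolyX_split m :
  'X_[m] = iota1 'X_[mnm_restrict e1 m] * iota2 'X_[mnm_restrict e2 m].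
Proof.
rewrite mpolyXE_id big_split_variables /= !mmapX.
by congr (_ * _); apply: eq_bigr => i _; rewrite mnmE.
Qed.

Lemma glue_representation (g : {mpoly K[N]}) :
  exists (r : nat) (m : 'I_r -> 'X_{1..N}),
    (forall a, m a \in msupp g) /\
    g = \sum_(a in [set: 'I_r]) iota1 (g@_(m a) *: 'X_[mnm_restrict e1 (m a)])
          * iota2 'X_[mnm_restrict e2 (m a)].
Proof.
exists (size (msupp g)), (fun a => nth 0%MM (msupp g) a); split=> [a|].
  exact: mem_nth.
rewrite {1}[g]mpolyE (big_nth 0%MM) big_mkord.
apply: eq_big => [a|a _]; first by rewrite inE.
by rewrite mmapZ -mulrA -mpolyX_split mul_mpolyC.
Qed.

Lemma glue_homog n (e : 'I_n -> 'I_N) d (p : {mpoly K[n]}) :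
  p \is d.-homog -> mmap (@mpolyC N K) (fun i => 'X_(e i)) p \is d.-homog.
Proof.
move=> homp; rewrite homog_piE -{1}[d]mul1n pihomog_subst //.
  by rewrite pihomog_dE.
by move=> i; rewrite dhomogX /= mdeg1.
Qed.

Section GlueIdeal.
Variables (I1 : {mpoly K[N1]} -> Prop) (I2 : {mpoly K[N2]} -> Prop).
Variables (T1 T2 : finType) (M1 M2 : nat).
Variables (h1 : T1 -> 'I_N1 -> {mpoly K[M1]}) (h2 : T2 -> 'I_N2 -> {mpoly K[M2]}).
Hypotheses (kerI1 : kernels I1 h1) (kerI2 : kernels I2 h2).

Local Notation I := (glue_ideal e1 e2 I1 I2).

Lemma glue_ideal1 p : I1 p -> I (iota1 p).
Proof. by move=> Ip; apply: ideal_gen_mem; left; exists p. Qed.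

Lemma glue_ideal2 p : I2 p -> I (iota2 p).
Proof. by move=> Ip; apply: ideal_gen_mem; right; exists p. Qed.

Lemma glue_ideal_independent1 (A : finType) (D : {set A}) u v :
    I (\sum_(a in D) iota1 (u a) * iota2 (v a)) -> independent_mod I2 D v ->
  forall a, a \in D -> I1 (u a).
Proof.
move=> Isum indv a aD; apply/kerI1.2 => t.
apply: (glue_map_independent splitP _ indv aD) => z.
apply: (glue_map_ideal splitP _ _ _ Isum); first exact: (kernels_ideal kerI2).
by move=> p /kerI1.2.
Qed.

End GlueIdeal.

End Glue.

(** * Witnesses for the sum of two ideals in disjoint variables *)

Section GlueWitness.
Variables (K : fieldType) (N1 N2 N : nat).
Variables (e1 : 'I_N1 -> 'I_N) (e2 : 'I_N2 -> 'I_N) (s : 'I_N -> 'I_N1 + 'I_N2).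
Hypothesis splitP : split_variables e1 e2 s.
Variables (I1 : {mpoly K[N1]} -> Prop) (I2 : {mpoly K[N2]} -> Prop).
Variables (T1 T2 : finType) (M1 M2 : nat).
Variables (h1 : T1 -> 'I_N1 -> {mpoly K[M1]}) (h2 : T2 -> 'I_N2 -> {mpoly K[M2]}).
Hypotheses (kerI1 : kernels I1 h1) (kerI2 : kernels I2 h2).

Local Notation iota1 := (mmap (@mpolyC N K) (fun i => 'X_(e1 i))).
Local Notation iota2 := (mmap (@mpolyC N K) (fun i => 'X_(e2 i))).
Local Notation I := (glue_ideal e1 e2 I1 I2).

Let idI : is_ideal I. Proof. exact: ideal_gen_ideal. Qed.

Lemma glue_ideal_independent2 (A : finType) (D : {set A}) u v :
    I (\sum_(a in D) iota1 (u a) * iota2 (v a)) -> independent_mod I1 D u ->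
  forall a, a \in D -> I2 (v a).
Proof.
move=> Isum; apply: (glue_ideal_independent1 (split_variables_sym splitP) kerI2 kerI1).
apply: glue_ideal_sym; move: Isum; congr (glue_ideal _ _ _ _ _).
by apply: eq_bigr => a _; rewrite mulrC.
Qed.

(** The label of a term is its degree in the first block. Elimination preserves labels, so the new
    factors are forms whose degrees still add up to [d]. *)
Lemma glue_homog_representation d f : f \is d.-homog ->
  exists (r : nat) (lab : 'I_r -> nat) (D : {set 'I_r}) u v,
    [/\ forall a, a \in D -> ((lab a <= d)%N /\ u a \is (lab a).-homog) /\
          ((lab a <= d)%N /\ v a \is (d - lab a)%N.-homog),
        I (f - \sum_(a in D) iota1 (u a) * iota2 (v a)),
        independent_mod I1 D u & independent_mod I2 D v].
Proof.
move=> homf; have [r [m [m_f def_f]]] := glue_representation splitP f.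
have degm a : d = (mdeg (mnm_restrict e1 (m a)) + mdeg (mnm_restrict e2 (m a)))%N.
  by rewrite -(mdeg_split splitP); apply/esym/(dhomog_mf homf)/m_f.
pose lab a := mdeg (mnm_restrict e1 (m a)).
have lab_le a : (lab a <= d)%N by rewrite (degm a) leq_addr.
have grad1 : graded_by lab (fun k p => (k <= d)%N /\ p \is k.-homog) I1.
  apply: (@graded_by_homog _ _ _ _ I1 (fun k => k <= d)%N id) => //.
    exact: (kernels_pihomog kerI1).
  exact: (kernels_ideal kerI1).
have grad2 : graded_by lab (fun k p => (k <= d)%N /\ p \is (d - k)%N.-homog) I2.
  apply: (@graded_by_homog _ _ _ _ I2 (fun k => k <= d)%N (fun k => d - k)%N).
  - exact: (kernels_pihomog kerI2).
  - by move=> i j le_i le_j eq_ij; rewrite -(subKn le_i) eq_ij subKn.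
  - exact: (kernels_ideal kerI2).
have [||D [u [v [Vuv If indu indv]]]] := independent_representation idI
    (@glue_ideal1 _ _ _ _ e1 e2 I1 I2) (@glue_ideal2 _ _ _ _ e1 e2 I1 I2) grad1 grad2
    (D := [set: 'I_r]) (u := fun a => f@_(m a) *: 'X_[mnm_restrict e1 (m a)])
    (h := fun a => 'X_[mnm_restrict e2 (m a)]).
- by move=> a _; split=> //; rewrite dhomogZ // dhomogX.
- by move=> a _; split=> //; rewrite dhomogX (degm a) /lab addKn.
by exists r, lab, D, u, v; rewrite {1}def_f.
Qed.

(** Modulo [I], [f] is a sum of products of forms, and primality of [P] isolates one product whose
    two factors are witnesses, the contractions of [P] being their colon ideals. *)
Lemma glue_witness_split d : vnumber_witness I d ->
  exists d1 d2, [/\ d = (d1 + d2)%N, vnumber_witness I1 d1 & vnumber_witness I2 d2].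
Proof.
move=> [f [P [homf [prP _] colP]]].
have [[P0 PD PM] P1 Ppr] := prP.
have [r [lab [D [u [v [Vuv If indu indv]]]]]] := glue_homog_representation homf.
(* Multiplying the representation of [f] by [iota1 q] leaves the [v a] untouched and independent, so
   each [q * u a] falls into [I1]. *)
have Pu q : P (iota1 q) -> forall a, a \in D -> I1 (q * u a).
  move=> /colP If'; apply: (glue_ideal_independent1 splitP kerI1 kerI2 _ indv).
  have : I (iota1 q * f - iota1 q * (f - \sum_(a in D) iota1 (u a) * iota2 (v a))).
    by apply: (ideal_sub idI) => //; case: idI => _ _; apply.
  rewrite -mulrBr subKr mulr_sumr; congr (glue_ideal _ _ _ _ _).
  by apply: eq_bigr => a _; rewrite rmorphM /= mulrA.
have Pv q : P (iota2 q) -> forall a, a \in D -> I2 (q * v a).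
  move=> /colP If'; apply: (glue_ideal_independent2 _ indu).
  have : I (iota2 q * f - iota2 q * (f - \sum_(a in D) iota1 (u a) * iota2 (v a))).
    by apply: (ideal_sub idI) => //; case: idI => _ _; apply.
  rewrite -mulrBr subKr mulr_sumr; congr (glue_ideal _ _ _ _ _).
  by apply: eq_bigr => a _; rewrite rmorphM /= mulrCA.
(* Otherwise each product is multiplied into [I] by some [w a] outside [P]; the product of the [w a]
   then multiplies [f] into [I] and lies in [P], against primality. *)
have [a aD colPa] : exists2 a, a \in D &
    forall q, I (q * (iota1 (u a) * iota2 (v a))) -> P q.
  apply: NNPP => noa.
  have sep a : exists q, a \in D -> I (q * (iota1 (u a) * iota2 (v a))) /\ ~ P q.
    case: (boolP (a \in D)) => [aD|_]; last by exists 0.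
    apply: NNPP => noq; apply: noa; exists a => // q Iq.
    by apply: NNPP => nPq; apply: noq; exists q.
  pose w a := proj1_sig (constructive_indefinite_description _ (sep a)).
  have wP a : a \in D -> I (w a * (iota1 (u a) * iota2 (v a))) /\ ~ P (w a).
    by rewrite /w; case: constructive_indefinite_description.
  suff : P (\prod_(a in D) w a) by case/(prime_bigprod prP) => a /wP[].
  apply/colP; rewrite /colon; set W := \prod_(a in D) w a.
  have -> : W * f = W * (f - \sum_(a in D) iota1 (u a) * iota2 (v a)) +
      \sum_(a in D) W * (iota1 (u a) * iota2 (v a)).
    by rewrite -mulr_sumr -mulrDr subrK.
  have [_ ID IM] := idI; apply: ID; first exact: IM.
  apply: ideal_bigsum idI _ => a aD; rewrite /W (bigD1 a) //= [w a * _]mulrC -mulrA.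
  exact/IM/(wP a aD).1.
have prime_preim n (phi : {rmorphism {mpoly K[n]} -> {mpoly K[N]}}) :
    prime_ideal (fun q => P (phi q)).
  split; first exact: (ideal_preim phi (And3 P0 PD PM)).
    by rewrite rmorph1.
  by move=> p q; rewrite rmorphM; apply: Ppr.
have [[le_d homu] [_ homv]] := Vuv a aD.
have col1 q : colon I1 (u a) q <-> P (iota1 q).
  split=> [Iq|/Pu]; last exact.
  apply: colPa; rewrite mulrA -rmorphM /=; apply: (ideal_mulr _ idI).
  exact: glue_ideal1.
have col2 q : colon I2 (v a) q <-> P (iota2 q).
  split=> [Iq|/Pv]; last exact.
  apply: colPa; rewrite mulrCA -rmorphM /=; case: idI => _ _; apply.
  exact: glue_ideal2.
exists (lab a), (d - lab a)%N; split; first by rewrite subnKC.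
  exists (u a), (fun q => P (iota1 q)); split=> //.
  by split; [exact: (prime_preim _ iota1) | exists (u a)].
exists (v a), (fun q => P (iota2 q)); split=> //.
by split; [exact: (prime_preim _ iota2) | exists (v a)].
Qed.

(** [Theta] is the tensor product of the two substitutions; its target is a polynomial ring over a
    domain, so its kernel is prime. The kernel is compared with the colon ideal of [F] through [Q],
    the sum of the extended primes, which both contain. *)
Lemma glue_witness d1 d2 :
  vnumber_witness I1 d1 -> vnumber_witness I2 d2 -> vnumber_witness I (d1 + d2).
Proof.
move=> [f1 [P1 [homf1 [prP1 _] colP1]]] [f2 [P2 [homf2 [prP2 _] colP2]]].
have [t1 kerP1] := kernels_prime kerI1 prP1 colP1.
have [t2 kerP2] := kernels_prime kerI2 prP2 colP2.
pose phi1 := mmap (@mpolyC M1 K) (h1 t1); pose phi2 := mmap (@mpolyC M2 K) (h2 t2).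
pose Theta := map_mpoly phi2 \o glue_map s (h1 t1).
have ThetaE g : Theta g = 0 <-> forall z, phi2 (glue_map s (h1 t1) g)@_z = 0.
  rewrite /Theta /=; split=> [g0 z|g0].
    by have := mcoeff_map_mpoly phi2 z (glue_map s (h1 t1) g); rewrite g0 mcoeff0.
  by apply/mpolyP => z; rewrite (mcoeff_map_mpoly phi2) mcoeff0; apply: g0.
have idP1 : is_ideal P1 by case: prP1.
have idP2 : is_ideal P2 by case: prP2.
set F := iota1 f1 * iota2 f2.
pose Q := glue_ideal e1 e2 P1 P2.
have QF g : Q g -> I (g * F).
  apply: (ideal_gen_min (colon_ideal F idI)) => _ [[q /colP1 Iq ->]|[q /colP2 Iq ->]].
    rewrite /colon /F mulrA -rmorphM /=; apply: (ideal_mulr _ idI).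
    exact: glue_ideal1.
  rewrite /colon /F mulrCA -rmorphM /=; case: idI => _ _; apply.
  exact: glue_ideal2.
have QTheta g : Q g -> Theta g = 0.
  move=> Qg; apply/ThetaE => z; apply/kerP2.
  by apply: (glue_map_ideal splitP _ idP2 _ Qg) => q /kerP1.
have colF g : colon I F g <-> Theta g = 0.
  have [r [m [_ def_g]]] := glue_representation splitP g.
  have [//|//|D [u [v [_ Qg indu indv]]]] := independent_representation
    (@ideal_gen_ideal _ _ : is_ideal Q)
    (@glue_ideal1 _ _ _ _ e1 e2 P1 P2) (@glue_ideal2 _ _ _ _ e1 e2 P1 P2)
    (graded_by_trivial _ idP1) (graded_by_trivial _ idP2) (D := [set: 'I_r])
    (u := fun a => g@_(m a) *: 'X_[mnm_restrict e1 (m a)])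
    (h := fun a => 'X_[mnm_restrict e2 (m a)]).
  rewrite -def_g in Qg; set g' := \sum_(a in D) _ in Qg.
  (* The [u a] are independent modulo [P1], so if all of them lie in [P1] no term is left and [g] is
     in [Q]. Both implications below reduce to this. *)
  have D0_Qg : (forall a, a \in D -> P1 (u a)) -> Q g.
    move=> Pu; suff D0 : D = set0 by move: Qg; rewrite /g' D0 big_set0 subr0.
    apply/setP => a; rewrite inE; apply/negP => aD.
    exact: (independent_mod_notin indu aD (Pu a aD)).
  split=> [IgF|g0].
    apply/QTheta/D0_Qg => a aD; apply/colP1.
    have Ig'F : I (g' * F).
      rewrite -[g'](subKr g) mulrBl; exact: (ideal_sub idI IgF (QF _ Qg)).
    apply: (@glue_ideal_independent1 _ _ _ _ _ _ _ splitP _ _ _ _ _ _ _ _ kerI1 kerI2 _ D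
      (fun a => u a * f1) (fun a => v a * f2)) aD.
      move: Ig'F; rewrite /g' mulr_suml; congr (glue_ideal _ _ _ _ _).
      by apply: eq_bigr => b _; rewrite /F !rmorphM /= mulrACA.
    (* A combination of the [v a * f2] in [I2] is a combination of the [v a] in [P2], the colon
       ideal of [f2]; so these products stay independent. *)
    move=> c Ic; apply: indv; apply/colP2; rewrite /colon mulr_suml.
    by move: Ic; congr I2; apply: eq_bigr => b _; rewrite scalerAl.
  apply/QF/D0_Qg => a aD; apply/kerP1.
  apply: (glue_map_independent splitP (I2 := P2) _ indv aD) => z; apply/kerP2.
  move: z; apply/ThetaE.
  have -> : \sum_(b in D) iota1 (u b) * iota2 (v b) = g - (g - g') by rewrite subKr.
  have -> : Theta (g - (g - g')) = Theta g - Theta (g - g').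
    by rewrite /Theta /= rmorphB /= rmorphB.
  by rewrite g0 QTheta // subrr.
exists F, (fun g => Theta g = 0); split; last exact: colF.
  by apply: dhomogM; apply: glue_homog.
by split; [exact: (ker_prime Theta) | exists F; exact: colF].
Qed.

Theorem vnumber_glue :
  ~ I1 1 -> ~ I2 1 -> vnumber I = (vnumber I1 + vnumber I2)%N.
Proof.
move=> /(kernels_witness kerI1)/vnumberP[W1 min1] /(kernels_witness kerI2)/vnumberP[W2 min2].
have W := glue_witness W1 W2.
have [Wv minv] := vnumberP (ex_intro _ _ W).
apply/eqP; rewrite eqn_leq minv //=.
have [d1 [d2 [-> /min1 le1 /min2 le2]]] := glue_witness_split Wv.
exact: leq_add.
Qed.

End GlueWitness.

(** * Disjoint unions and components of graphs *)

Section VertexRenaming.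
Variables (K : fieldType) (m m' : nat) (v : 'I_m' -> 'I_m).

Definition rename_vertices (k : 'I_(m' + m')) : 'I_(m + m) :=
  match split k with
  | inl i => lshift m (v i)
  | inr i => rshift m (v i)
  end.

Lemma rename_vertices_binomial i j :
  mmap (@mpolyC _ K) (fun k => 'X_(rename_vertices k)) (edge_binomial K i j) =
  edge_binomial K (v i) (v j).
Proof.
rewrite rmorphB !rmorphM /= !mmapXU /rename_vertices.
by rewrite !(unsplitK (inl _)) !(unsplitK (inr _)).
Qed.

End VertexRenaming.

Lemma split_rename_vertices m m1 m2 (v1 : 'I_m1 -> 'I_m) (v2 : 'I_m2 -> 'I_m) s :
  split_variables v1 v2 s -> exists s',
  split_variables (rename_vertices v1) (rename_vertices v2) s'.
Proof.
move=> [sv1 sv2 sK].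
exists (fun k => match split k with
  | inl i => match s i with inl a => inl (lshift m1 a) | inr b => inr (lshift m2 b) end
  | inr i => match s i with inl a => inl (rshift m1 a) | inr b => inr (rshift m2 b) end
  end); split=> k; rewrite /rename_vertices.
- rewrite -{2}(splitK k); case: (split k) => a /=.
    by rewrite (unsplitK (inl _)) sv1.
  by rewrite (unsplitK (inr _)) sv1.
- rewrite -{2}(splitK k); case: (split k) => a /=.
    by rewrite (unsplitK (inl _)) sv2.
  by rewrite (unsplitK (inr _)) sv2.
- rewrite -{1}(splitK k); case: (split k) => i /=; rewrite {1}[i]sK;
    by case: (s i) => a; rewrite ?(unsplitK (inl _)) ?(unsplitK (inr _)).
Qed.

Lemma vnumber_ext (K : fieldType) N (I J : {mpoly K[N]} -> Prop) :
  (forall p, I p <-> J p) -> vnumber I = vnumber J.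
Proof.
move=> eqIJ; congr vnumber; apply: functional_extensionality => p.
exact: propositional_extensionality.
Qed.

Theorem vnumber_disjoint_union (K : fieldType) m m1 m2 (H : simple_graph m)
    (H1 : simple_graph m1) (H2 : simple_graph m2) (v1 : 'I_m1 -> 'I_m)
    (v2 : 'I_m2 -> 'I_m) :
    injective v1 -> injective v2 -> (forall i j, v1 i != v2 j) ->
    (m <= m1 + m2)%N ->
    (forall i j, H (v1 i) (v1 j) = H1 i j) -> (forall i j, H (v2 i) (v2 j) = H2 i j) ->
    (forall i j, ~~ H (v1 i) (v2 j)) ->
  vnumber (binomial_edge_ideal K H) =
    (vnumber (binomial_edge_ideal K H1) + vnumber (binomial_edge_ideal K H2))%N.
Proof.
move=> inj1 inj2 dis le_m HE1 HE2 noH.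
have [s splitv] : exists s, split_variables v1 v2 s.
  pose v k := match k with inl i => v1 i | inr i => v2 i end.
  have injv : injective v.
    move=> [i|i] [j|j] /= eq_ij; rewrite ?(inj1 _ _ eq_ij) ?(inj2 _ _ eq_ij) //.
      by have := dis i j; rewrite eq_ij eqxx.
    by have := dis j i; rewrite -eq_ij eqxx.
  (* [v] injects [m1 + m2] elements into [m <= m1 + m2], hence is a bijection; its inverse is
     [s]. *)
  have [|s vs sv] := inj_card_bij injv; first by rewrite card_sum !card_ord.
  exists s; split=> [i|i|k]; [exact: (vs (inl i)) | exact: (vs (inr i))|].
  by rewrite -{1}[k]sv; case: (s k).
have [s' splitP] := split_rename_vertices splitv.
rewrite (vnumber_ext (@binomial_edge_idealE K m H)).
rewrite (vnumber_ext (@binomial_edge_idealE K m1 H1)).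
rewrite (vnumber_ext (@binomial_edge_idealE K m2 H2)).
have [T1 [h1 ker1]] := edge_ideal_kernels K (@edge_sym _ H1).
have [T2 [h2 ker2]] := edge_ideal_kernels K (@edge_sym _ H2).
rewrite -(vnumber_glue splitP ker1 ker2 (@edge_ideal_proper _ _ _) (@edge_ideal_proper _ _ _)).
apply: vnumber_ext => p; have [_ _ sK] := splitv; split.
  apply: edge_ideal_min (@ideal_gen_ideal _ _) _ => i j.
  rewrite [i]sK [j]sK; case: (s i) => a; case: (s j) => b Hab.
  - apply: ideal_gen_mem; left; exists (edge_binomial K a b).
      by apply: edge_ideal_mem; rewrite -HE1.
    by rewrite rename_vertices_binomial.
  - by have := noH a b; rewrite Hab.
  - by have := noH b a; rewrite edge_sym Hab.
  - apply: ideal_gen_mem; right; exists (edge_binomial K a b).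
      by apply: edge_ideal_mem; rewrite -HE2.
    by rewrite rename_vertices_binomial.
have idE := @edge_ideal_is_ideal K m H.
apply: (ideal_gen_min idE) => _ [[q Iq ->]|[q Iq ->]];
  move: q Iq => q; apply: (edge_ideal_min (ideal_preim _ idE)) => i j Hij /=;
  rewrite rename_vertices_binomial; apply: edge_ideal_mem.
  by rewrite HE1.
by rewrite HE2.
Qed.

(** * Induced subgraphs and connected components *)

Section Components.
Variables (K : fieldType) (n : nat) (G : simple_graph n).

Local Notation J A := (binomial_edge_ideal K (induced G A)).

Lemma vnumber_induced_setU (A B : {set 'I_n}) :
    [disjoint A & B] -> (forall i j, i \in A -> j \in B -> ~~ G i j) ->
  vnumber (J (A :|: B)) = (vnumber (J A) + vnumber (J B))%N.
Proof.
move=> disAB noG.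
have memA (i : 'I_#|A|) : enum_val i \in A :|: B by rewrite inE enum_valP.
have memB (i : 'I_#|B|) : enum_val i \in A :|: B by rewrite inE enum_valP orbT.
pose vA i := enum_rank_in (memA i) (enum_val i).
pose vB i := enum_rank_in (memB i) (enum_val i).
have vAK i : enum_val (vA i) = enum_val i by rewrite enum_rankK_in.
have vBK i : enum_val (vB i) = enum_val i by rewrite enum_rankK_in.
apply: (@vnumber_disjoint_union _ _ _ _ _ _ _ vA vB) => [i j|i j|i j||i j|i j|i j].
- by move/(congr1 enum_val); rewrite !vAK => /enum_val_inj.
- by move/(congr1 enum_val); rewrite !vBK => /enum_val_inj.
- apply/eqP => /(congr1 enum_val); rewrite vAK vBK => eq_ij.
  by have := disjointFr disAB (enum_valP i); rewrite eq_ij enum_valP.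
- by move: disAB; rewrite -leq_card_setU => /eqP ->.
- by rewrite /= /induced_edge !vAK.
- by rewrite /= /induced_edge !vBK.
- by rewrite /= /induced_edge vAK vBK; apply: noG; apply: enum_valP.
Qed.

(** The empty set is the disjoint union of two copies of itself, so the value equals its own
    double. *)
Lemma vnumber_induced_set0 : vnumber (J set0) = 0%N.
Proof.
have := @vnumber_induced_setU set0 set0; rewrite setU0 disjoints_subset sub0set.
move=> /(_ isT) eq0; apply/eqP; rewrite -(eqn_add2l (vnumber (J set0))) addn0.
by rewrite -eq0 // => i j; rewrite inE.
Qed.

(** [G] is the disjoint union of its renumbered copy on all vertices and of the empty graph, which
    contributes 0; this takes care of the change of polynomial ring. *)
Lemma vnumber_induced_setT : vnumber (J setT) = vnumber (binomial_edge_ideal K G).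
Proof.
rewrite -[LHS]addn0 -vnumber_induced_set0; symmetry.
apply: (@vnumber_disjoint_union _ _ _ _ _ _ _ (@enum_val _ setT) (@enum_val _ set0)) => //.
- exact: enum_val_inj.
- exact: enum_val_inj.
- by move=> i j; have := enum_valP j; rewrite inE.
- by rewrite cardsT card_ord leq_addr.
- by move=> i j; have := enum_valP j; rewrite inE.
Qed.

Lemma vnumber_induced_cover (D : {set {set 'I_n}}) :
    trivIset D ->
    (forall A B, A \in D -> B \in D -> A != B ->
      forall i j, i \in A -> j \in B -> ~~ G i j) ->
  vnumber (J (cover D)) = (\sum_(A in D) vnumber (J A))%N.
Proof.
move: {2}#|D| (erefl #|D|) => s; elim: s D => [|s IHs] D cardD triv noG.
  move/eqP: cardD; rewrite cards_eq0 => /eqP ->.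
  by rewrite /cover !big_set0 vnumber_induced_set0.
have [A AD] : exists A, A \in D by apply/card_gt0P; rewrite cardD.
have sD B : B \in D :\ A -> B != A /\ B \in D by case/setD1P.
rewrite (big_setD1 A AD) /= -IHs.
- rewrite /cover (big_setD1 A AD) /= vnumber_induced_setU //.
    apply: bigcup_disjoint => B /sD[ne_BA BD].
    by have /trivIsetP := triv; apply=> //; rewrite eq_sym.
  move=> i j iA /bigcupP[B /sD[ne_BA BD] jB]; apply: noG AD BD _ _ _ iA jB.
  by rewrite eq_sym.
- by move: cardD; rewrite (cardsD1 A) AD => -[].
- exact: trivIsetS (subsetDl _ _) triv.
- by move=> B C /sD[_ BD] /sD[_ CD]; apply: noG.
Qed.

Lemma connect_equivalence : {in [set: 'I_n] & &, equivalence_rel (connect G)}.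
Proof.
have symG : connect_sym G by apply/sym_connect_sym/edge_sym.
by move=> i j k _ _ _; split=> [|Gij]; [exact: connect0 | exact: same_connect].
Qed.

Lemma components_partition : partition (components G) [set: 'I_n].
Proof. exact/equivalence_partitionP/connect_equivalence. Qed.

Lemma components_edge A i j : A \in components G -> i \in A -> G i j -> j \in A.
Proof.
have /and3P[_ triv _] := components_partition => AC iA Gij.
rewrite -(def_pblock triv AC iA).
by rewrite (pblock_equivalence_partition connect_equivalence) ?inE // connect1.
Qed.

Lemma binomial_edge_ideal_components p :
  binomial_edge_ideal K G p <->
  ideal_sum (components G) (fun A => ideal_extension (poly_incl K A) (J A)) p.
Proof.
have inclE (A : {set 'I_n}) i j : poly_incl K A (edge_binomial K i j) =
    edge_binomial K (enum_val i) (enum_val j).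
  rewrite /poly_incl rmorphB !rmorphM /= !mmapXU /var_incl.
  by rewrite !(unsplitK (inl _)) !(unsplitK (inr _)).
have idE := @edge_ideal_is_ideal K n G.
have idJ A := @ideal_gen_ideal _ (fun q => exists2 p, J A p & q = poly_incl K A p).
rewrite binomial_edge_idealE; split.
  apply: edge_ideal_min.
    split=> [|_ _ [f [If ->]] [g [Ig ->]]|c _ [f [If ->]]].
    - by exists (fun=> 0); split=> [A _|]; [have [] := idJ A | rewrite big1].
    - exists (fun A => f A + g A); split=> [A AC|]; last by rewrite big_split.
      by have [_ ID _] := idJ A; apply: ID; [apply: If | apply: Ig].
    - exists (fun A => c * f A); split=> [A AC|]; last by rewrite mulr_sumr.
      by have [_ _ IM] := idJ A; apply: IM; apply: If.
  move=> i j Gij; have /and3P[/eqP covT _ _] := components_partition.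
  have [A AC iA] : exists2 A, A \in components G & i \in A.
    by apply/bigcupP; rewrite -/(cover _) covT inE.
  have jA := components_edge AC iA Gij.
  (* An edge lies inside one component, so its binomial is placed in that summand and 0 in the
     others. *)
  exists (fun B => if B == A then edge_binomial K i j else 0); split=> [B _|].
    case: eqP => [->|_]; last by have [] := idJ B.
    apply: ideal_gen_mem; exists (edge_binomial K (enum_rank_in iA i) (enum_rank_in iA j)).
      apply/binomial_edge_idealE/edge_ideal_mem.
      by rewrite /= /induced_edge !enum_rankK_in.
    by rewrite inclE !enum_rankK_in.
  by rewrite (bigD1 A) //= eqxx big1 ?addr0 // => B /andP[_ /negPf ->].
move=> [f [If ->]]; apply: ideal_bigsum (idE) _ => A /If.
apply: (ideal_gen_min idE) => _ [q /binomial_edge_idealE Iq ->].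
have id_preim : is_ideal (fun r => edge_ideal G (poly_incl K A r)).
  exact: (ideal_preim (mmap (@mpolyC (n + n) K) (@var_incl K n A)) idE).
apply: (edge_ideal_min id_preim _ Iq) => i j Gij.
by rewrite inclE; apply: edge_ideal_mem.
Qed.

End Components.

Theorem proposition3p1 (n : nat) (G : simple_graph n) (K : fieldType) :
  let J_G := binomial_edge_ideal K G in
  let J (A : {set 'I_n}) := binomial_edge_ideal K (induced G A) in
  let JS (A : {set 'I_n}) := ideal_extension (poly_incl K A) (J A) in
  vnumber J_G = vnumber (ideal_sum (components G) JS) /\
  vnumber (ideal_sum (components G) JS)
    = (\sum_(A in components G) vnumber (J A))%N.
Proof.
move=> J_G J JS.
have eqJ : vnumber J_G = vnumber (ideal_sum (components G) JS).
  by apply: vnumber_ext => p; apply: binomial_edge_ideal_components.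
split=> //; rewrite -eqJ -vnumber_induced_setT.
have /and3P[/eqP <- triv _] := components_partition G.
apply: vnumber_induced_cover (triv) _ => A B AC BC ne_AB i j iA jB.
have /trivIsetP/(_ A B AC BC ne_AB) disAB := triv.
apply/negP => /(components_edge AC iA) jA.
by rewrite (disjointFr disAB jA) in jB.
Qed.
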